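(* With the notation and assumptions of the context, let $i\in\{1,\ldots,g\}$ and $n\in\mathbb{Z}_{>0}$. Suppose that $e_{ii}^{(k)}\in O_K^*$ for all $k\in\mathbb{Z}_{\ge0}$. Then there exists a finite extension $K'$ of $K$ such that, upon replacing $K$ by $K'$, $|T_{n,i}|=p^n$. Moreover, for any $\pi\in T_{n,i}\setminus\{0\}$ there exists $s\in\{1,\ldots,n\}$ such that $|\pi|=|p|^{1/(p^s-p^{s-1})}$, and for any $s\in\{1,\ldots,n\}$ the cardinality of the set $\{\pi\in T_{n,i} : |\pi|=|p|^{1/(p^s-p^{s-1})}\}$ is exactly $p^s-p^{s-1}$.
   Context: $p$ is a prime, $K$ a finite extension of $\mathbb{Q}_p$, $|\cdot|$ its absolute value (extended to finite extensions) with $|p|=1/p$, $O_K=\{|a|\le1\}$, $\mathcal{M}_K=\{|a|<1\}$. $K((\frac1T))$ is the field of series $\sum_{i\le n}v_iT^i$; the degree is the largest exponent with nonzero coefficient. $A\subset K((\frac1T))$ is a $K$-subalgebra with $A\cap K[[\frac1T]]=K$ and $g:=\dim_KK((\frac1T))/(A+K[[\frac1T]])<\infty$. Put $\underline{M}(A)=\{\deg v : 0\ne v\in A\}=\{s_1<s_2<\cdots\}\subset\mathbb{Z}_{\ge0}$ and $\mathbb{Z}_{\ge0}\setminus\underline{M}(A)=\{\mu_1<\cdots<\mu_g\}$. The standard basis of $A$ is the unique basis $v_i=\sum_jv_{ij}T^j$ with $v_i$ monic of degree $s_i$ and $v_{i,s_j}=0$ for $i>j\ge1$; $A$ is assumed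 strictly integral, i.e. all $v_{ij}\in O_K$. $d$ is an integer with $p\equiv1\bmod d$ and $d\ge\mu_g$, $\zeta_d\in\mathbb{Z}_p$ is a primitive $d$-th root of unity, and the automorphism $\delta:\sum a_nT^n\mapsto\sum a_n(\zeta_dT)^n$ of $K((\frac1T))$ is assumed to restrict to an automorphism of $A$. Let $O(A)$ be the set of elements of $A$ with coefficients in $O_K$; one has $O_K[[\frac1T]][T]=O(A)\oplus\frac1TO_K[[\frac1T]]\oplus\bigoplus_iO_KT^{\mu_i}$, and $\mathbf{e}^{(k)}=(e^{(k)}_{ij})\in M_g(O_K)$ is defined by $T^{\mu_jp^k}-\sum_ie^{(k)}_{ij}T^{\mu_i}\in O(A)\oplus\frac1TO_K[[\frac1T]]$; under the present assumptions it is diagonal. Put $l_i(X):=\sum_{k\ge0}\frac{e^{(k)}_{ii}}{p^k}X^{p^k}$ and $$T_{n,i}:=\{\pi\in\mathcal{M}_K : l_i(\pi)=0,\ |\pi|\le|p|^{1/(p^n-p^{n-1})}\}.$$ ''Replacing $K$ by $K'$'' means taking $\pi\in\mathcal{M}_{K'}$ in the definition of $T_{n,i}$, with $l_i$ unchanged. *)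

(* Defs.v *)
From HB Require Import structures.
From mathcomp Require Import all_boot all_order all_algebra all_field.
From mathcomp Require Import all_classical all_reals all_analysis.

Set Implicit Arguments.
Unset Strict Implicit.
Unset Printing Implicit Defensive.

Import Order.TTheory GRing.Theory Num.Theory.
Import numFieldNormedType.Exports.

Local Open Scope classical_set_scope.
Local Open Scope ring_scope.

Section AbsoluteValues.
Variable R : realType.

Definition nonarch_absval (F : fieldType) (abs : F -> R) : Prop :=
  [/\ forall x, 0 <= abs x,
      forall x, abs x = 0 <-> x = 0,
      {morph abs : x y / x * y}
    & forall x y, abs (x + y) <= Num.max (abs x) (abs y)].

(* x is a unit of the ring {abs <= 1}. *)
Definition integer_unit (F : fieldType) (abs : F -> R) (x : F) : Prop :=
  abs x <= 1 /\ exists2 y, abs y <= 1 & x * y = 1.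

Definition abs_cvg (F : fieldType) (abs : F -> R) (u : nat -> F) (l : F) : Prop :=
  abs (u n - l) @[n --> \oo] --> (0 : R).

Definition abs_cauchy (F : fieldType) (abs : F -> R) (u : nat -> F) : Prop :=
  forall eps : R, 0 < eps ->
  exists N : nat, forall m n : nat, (N <= m)%N -> (N <= n)%N ->
    abs (u m - u n) < eps.

Definition rat_padic_abs (p : nat) (q : rat) : R :=
  if q == 0 then 0
  else (p ^ logn p `|denq q|)%:R / (p ^ logn p `|numq q|)%:R.

(* The field of p-adic numbers with its absolute value, characterized (up to
   unique isomorphism) as the completion of the rationals for the p-adic
   absolute value. *)
Record is_padic_field (p : nat) (Qp : fieldType) (abs : Qp -> R) : Prop := {
  padic_absval : nonarch_absval abs;
  padic_ratr : forall q : rat, abs (ratr q) = rat_padic_abs p q;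
  padic_dense : forall (x : Qp) (eps : R), 0 < eps ->
    exists q : rat, abs (x - ratr q) < eps;
  padic_complete : forall u : nat -> Qp, abs_cauchy abs u ->
    exists l : Qp, abs_cvg abs u l }.

Definition absval_extends (F : fieldType) (E : fieldExtType F)
    (absF : F -> R) (absE : E -> R) : Prop :=
  nonarch_absval absE /\ forall x : F, absE x%:A = absF x.

End AbsoluteValues.

(* A formal series sum_i (u i) T^i is represented by its coefficient function
   u : int -> K. *)
Section LaurentSeries.
Variable K : fieldType.
Implicit Types (u v : int -> K) (A : set (int -> K)).

(* K((1/T)) *)
Definition laurent : set (int -> K) :=
  [set u | exists n : int, forall i : int, n < i -> u i = 0].

(* K[[1/T]] *)
Definition power_series : set (int -> K) :=
  [set u | forall i : int, 0 < i -> u i = 0].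

Definition Tpow (m : int) : int -> K := fun i => (i == m)%:R.

(* The summand has finite support when u and v are Laurent series in 1/T. *)
Definition laurent_mul u v : int -> K :=
  fun n => \sum_(i \in [set: int]) u i * v (n - i).

Definition laurent_deg u (n : int) : Prop :=
  u n != 0 /\ forall i : int, n < i -> u i = 0.

Definition laurent_subalgebra A : Prop :=
  [/\ A `<=` laurent,
      A (Tpow 0),
      forall u v, A u -> A v -> A (u \+ v),
      forall (c : K) u, A u -> A (c \*o u)
    & forall u v, A u -> A v -> A (laurent_mul u v)].

Definition set_add A (B : set (int -> K)) : set (int -> K) :=
  [set u | exists a b, [/\ A a, B b & u = a \+ b]].

(* dim_K V/W = g: some g elements of V form a basis of V modulo W. *)
Definition quotient_dim (V W : set (int -> K)) (g : nat) : Prop :=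
  exists b : 'I_g -> int -> K,
    (forall j, V (b j)) /\
    forall v, V v ->
      exists! c : {ffun 'I_g -> K},
        W (fun n => v n - \sum_(j < g) c j * b j n).

Definition degree_set A : set int :=
  [set m | exists2 u, A u & laurent_deg u m].

(* s 0 < s 1 < ... and mu 0 < ... < mu (g - 1): indices are shifted by one. *)
Definition degree_enum A (s : nat -> nat) : Prop :=
  {homo s : i j / (i < j)%N} /\ degree_set A = range (fun i => (s i)%:Z).

Definition gap_enum A (g : nat) (mu : 'I_g -> nat) : Prop :=
  {homo mu : i j / (i < j)%N} /\
  [set m : nat | ~ degree_set A m%:Z] = range mu.

Definition is_basis A (v : nat -> int -> K) : Prop :=
  [/\ forall i, A (v i),
      forall u, A u -> exists (N : nat) (c : 'I_N -> K),
        u = (fun n => \sum_(i < N) c i * v i n)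
    & forall (N : nat) (c : 'I_N -> K),
        (forall n : int, \sum_(i < N) c i * v i n = 0) -> forall i, c i = 0].

Definition standard_basis A (s : nat -> nat) (v : nat -> int -> K) : Prop :=
  [/\ degree_enum A s,
      is_basis A v,
      forall i, laurent_deg (v i) (s i)%:Z /\ v i (s i)%:Z = 1
    & forall i j : nat, (j < i)%N -> v i (s j)%:Z = 0].

(* The substitution T |-> z T. *)
Definition scale_var (z : K) u : int -> K := fun n => u n * z ^ n.

Variables (R : realType) (abs : K -> R).

Definition integral_series : set (int -> K) :=
  [set u | forall n : int, abs (u n) <= 1].

Definition strictly_integral A : Prop :=
  exists (s : nat -> nat) (v : nat -> int -> K),
    standard_basis A s v /\ forall i, integral_series (v i).

(* M is the matrix e^(k), with q = p ^ k; the two summands are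
   O(A) and (1/T) O_K[[1/T]]. *)
Definition frobenius_matrix A (g : nat) (mu : 'I_g -> nat) (q : nat)
    (M : 'M[K]_g) : Prop :=
  (forall i j, abs (M i j) <= 1) /\
  forall j : 'I_g,
    set_add (A `&` integral_series)
            ([set u | forall i : int, 0 <= i -> u i = 0] `&` integral_series)
      (fun n => Tpow (mu j * q)%N%:Z n
                - \sum_(i < g) M i j * Tpow (mu i)%:Z n).

End LaurentSeries.

Arguments laurent K _ : clear implicits.
Arguments power_series K _ : clear implicits.
Arguments Tpow K m _ : clear implicits.

Section Torsion.
Variables (R : realType) (p : nat) (K : fieldType) (K' : fieldExtType K).
Variable abs : K' -> R.

(* |p|^(1 / (p^n - p^(n-1))), for n > 0 *)
Definition torsion_radius (n : nat) : R :=
  abs p%:R `^ ((p ^ n - p ^ n.-1)%N%:R)^-1.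

(* l(x) = y, where l(X) = sum_k (a k / p^k) X^(p^k) *)
Definition log_value (a : nat -> K) (x y : K') : Prop :=
  abs_cvg abs
    (fun N : nat => \sum_(k < N) (a k)%:A / p%:R ^+ k * x ^+ (p ^ k)%N) y.

Definition torsion_set (a : nat -> K) (n : nat) : set K' :=
  [set x | [/\ abs x < 1, log_value a x 0 & abs x <= torsion_radius n]].

End Torsion.

(* Main.v *)
Require Import Defs.
From HB Require Import structures.
From mathcomp Require Import all_boot all_order all_algebra all_field.
From mathcomp Require Import all_classical all_reals all_analysis.
From mathcomp Require Import ring lra zify.

(**
Only the series l(X) = sum_k (a_k / p^k) X^(p^k) with all |a_k| = 1 matters.
Its Newton polygon has the vertices (p^k, -k), so the truncation l_N has
p^s - p^(s-1) roots of absolute value r_s = |p|^(1/(p^s - p^(s-1))) for every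
s < N, and they are simple because l' is a unit on the open unit disc. The
extension K' is a splitting field of l_N, where N is so large that the
omitted terms are at most |p| r_n on the disc |x| <= r_n. On the balls of
radius |p| r_n in that disc, l and l_N are isometries with derivative close
to a_0, hence Newton iteration in the complete field K' matches the zeros of
l with those of l_N, preserving the absolute values.

The absolute value of K is extended to K' without using completeness: a
pointwise minimal submultiplicative ultrametric norm f on K' with f(1) = 1
and f <= | | on K is multiplicative. Indeed, let r < f(a). The quotient norm
on K' = K'[X]/(X - a) with |X| = r would be smaller than f, so it must give
1 a value < 1, which forces f(a^-n) r^n to be bounded. Combined with
the same bound for a^-1, this yields f(a) f(a^-1) = 1.
*)

Set Implicit Arguments.
Unset Strict Implicit.
Unset Printing Implicit Defensive.

Import Order.TTheory GRing.Theory Num.Theory.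
Import numFieldNormedType.Exports.

Local Open Scope classical_set_scope.
Local Open Scope ring_scope.
Local Open Scope card_scope.

(** * Absolute values and completeness *)

Section NonarchimedeanAbsoluteValue.
Variables (R : realType) (F : fieldType) (abs : F -> R).
Hypothesis nabs : nonarch_absval abs.
Implicit Types (x y : F) (r : R).

Lemma abs_ge0 x : 0 <= abs x. Proof. by case: nabs. Qed.

Lemma absM : {morph abs : x y / x * y}. Proof. by case: nabs. Qed.

Lemma abs_eq0 x : (abs x == 0) = (x == 0).
Proof. by case: nabs => _ h _ _; apply/eqP/eqP => /h. Qed.

Lemma abs0 : abs 0 = 0. Proof. by apply/eqP; rewrite abs_eq0. Qed.

Lemma abs_gt0 x : (0 < abs x) = (x != 0).
Proof. by rewrite lt_def abs_eq0 abs_ge0 andbT. Qed.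

Lemma abs1 : abs 1 = 1.
Proof.
have /mulfI : abs 1 != 0 by rewrite abs_eq0 oner_eq0.
by apply; rewrite -absM !mulr1.
Qed.

Lemma absX x m : abs (x ^+ m) = abs x ^+ m.
Proof. by elim: m => [|m IHm]; rewrite ?abs1 // !exprS absM IHm. Qed.

Lemma absV x : abs x^-1 = (abs x)^-1.
Proof.
have [->|x0] := eqVneq x 0; first by rewrite invr0 abs0 invr0.
have ax0 : abs x != 0 by rewrite abs_eq0.
by apply: (mulfI ax0); rewrite -absM !divff // abs1.
Qed.

Lemma absN x : abs (- x) = abs x.
Proof.
rewrite -mulN1r absM; suff -> : abs (-1) = 1 by rewrite mul1r.
apply/eqP; rewrite -(@eqrXn2 _ 2) ?abs_ge0 //.
by rewrite -absX sqrrN !expr1n abs1.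
Qed.

Lemma absBC x y : abs (x - y) = abs (y - x).
Proof. by rewrite -opprB absN. Qed.

Lemma absD_le r x y : abs x <= r -> abs y <= r -> abs (x + y) <= r.
Proof.
case: nabs => _ _ _ h hx hy; apply: le_trans (h x y) _.
by rewrite ge_max hx.
Qed.

Lemma absD_lt r x y : abs x < r -> abs y < r -> abs (x + y) < r.
Proof.
case: nabs => _ _ _ h hx hy; apply: le_lt_trans (h x y) _.
by rewrite gt_max hx.
Qed.

Lemma absB_le r x y : abs x <= r -> abs y <= r -> abs (x - y) <= r.
Proof. by move=> hx hy; rewrite absD_le ?absN. Qed.

Lemma absB_lt r x y : abs x < r -> abs y < r -> abs (x - y) < r.
Proof. by move=> hx hy; rewrite absD_lt ?absN. Qed.

Lemma abs_sum_le (I : Type) (s : seq I) (P : pred I) (f : I -> F) r :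
  0 <= r -> (forall i, P i -> abs (f i) <= r) -> abs (\sum_(i <- s | P i) f i) <= r.
Proof.
move=> r0 hf; elim/big_rec: _ => [|i x Pi]; first by rewrite abs0.
by apply: absD_le; apply: hf.
Qed.

Lemma abs_sum_lt (I : Type) (s : seq I) (P : pred I) (f : I -> F) r :
  0 < r -> (forall i, P i -> abs (f i) < r) -> abs (\sum_(i <- s | P i) f i) < r.
Proof.
move=> r0 hf; elim/big_rec: _ => [|i x Pi]; first by rewrite abs0.
by apply: absD_lt; apply: hf.
Qed.

Lemma abs_dominant x y : abs y < abs x -> abs (x + y) = abs x.
Proof.
move=> yx; apply/le_anti; rewrite absD_le ?(ltW yx) //= leNgt; apply/negP => h.
by have := absB_lt h yx; rewrite addrK ltxx.
Qed.

Lemma abs_close x y : abs (x - y) < abs x -> abs y = abs x.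
Proof.
move=> h; have -> : y = x - (x - y) by ring.
by rewrite abs_dominant ?absN.
Qed.

Lemma abs_cvgP (u : nat -> F) l :
  abs_cvg abs u l <->
  forall eps : R, 0 < eps -> exists N : nat, forall m, (N <= m)%N -> abs (u m - l) < eps.
Proof.
split=> [/cvgr0Pnorm_lt h eps e0|h].
  have [N _ hN] := h _ e0; exists N => m Nm.
  by have := hN m Nm; rewrite /= ger0_norm // abs_ge0.
apply/cvgr0Pnorm_lt => eps e0; have [N hN] := h _ e0.
by exists N => // m Nm /=; rewrite ger0_norm ?abs_ge0 ?hN.
Qed.

Lemma abs_cvg_cauchy (u : nat -> F) l : abs_cvg abs u l -> abs_cauchy abs u.
Proof.
move=> /abs_cvgP h eps e0; have [N hN] := h _ e0; exists N => m k Nm Nk.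
have -> : u m - u k = (u m - l) - (u k - l) by ring.
by rewrite absB_lt ?hN.
Qed.

Lemma abs_cvg0_cst x : abs_cvg abs (fun=> x) 0 -> x = 0.
Proof.
move=> /abs_cvgP h; apply/eqP/negPn; rewrite -abs_gt0; apply/negP => /h[N hN].
by have := hN _ (leqnn N); rewrite subr0 ltxx.
Qed.

End NonarchimedeanAbsoluteValue.

(** * Completeness of finite extensions of a complete field *)

Section Completeness.
Variables (R : realType).

Definition abs_complete (F : fieldType) (abs : F -> R) : Prop :=
  forall u : nat -> F, abs_cauchy abs u -> exists l : F, abs_cvg abs u l.

Variables (F : fieldType) (E : fieldExtType F) (absF : F -> R) (absE : E -> R).
Hypothesis extE : absval_extends absF absE.
Let nE : nonarch_absval absE. Proof. by case: extE. Qed.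

Lemma abs_scale (c : F) (x : E) : absE (c *: x) = absF c * absE x.
Proof. by case: extE => _ h; rewrite -mulr_algl absM // h. Qed.

(** The limit has to lie in V, so this includes closedness, which the induction on the dimension
    needs. *)
Definition complete_subspace (V : {vspace E}) : Prop :=
  forall u : nat -> E, abs_cauchy absE u -> (forall m, u m \in V) ->
    exists2 l : E, l \in V & abs_cvg absE u l.

(** Otherwise elements of V would converge to x, and by uniqueness of limits x would lie in V. *)
Lemma complete_subspace_dist (V : {vspace E}) (x : E) :
  complete_subspace V -> x \notin V ->
  exists2 delta : R, 0 < delta & forall y, y \in V -> delta <= absE (x + y).
Proof.
move=> cV xV; apply: contrapT => hn.
have /choice[u hu] : forall m, exists y, y \in V /\ absE (x - y) < m.+1%:R^-1.
  move=> m; apply: contrapT => hm; apply: hn; exists m.+1%:R^-1.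
    by rewrite invr_gt0 ltr0n.
  move=> y yV; rewrite leNgt; apply/negP => h; apply: hm.
  by exists (- y); rewrite memvN yV opprK.
have ux : abs_cvg absE u x.
  apply/abs_cvgP => // eps e0.
  have [N hN] : exists N : nat, N.+1%:R^-1 < eps.
    exists (Num.bound eps^-1).
    rewrite invf_plt ?posrE ?ltr0n //; apply: lt_le_trans (archi_boundP _) _.
      by rewrite invr_ge0 ltW.
    by rewrite ler_nat.
  exists N => m Nm; rewrite absBC //; apply: lt_trans (hu m).2 _.
  by apply: le_lt_trans hN; rewrite lef_pV2 ?posrE ?ltr0n // ler_nat.
have [l lV /abs_cvgP ul] := cV u (abs_cvg_cauchy nE ux) (fun m => (hu m).1).
have xl : x - l = 0.
  apply: (abs_cvg0_cst nE); apply/abs_cvgP => // eps e0.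
  have [N1 h1] := ul nE eps e0; have [N2 h2] := (abs_cvgP nE _ _).1 ux eps e0.
  exists 0%N => _ _; rewrite subr0; set k := maxn N1 N2.
  have -> : x - l = (u k - l) - (u k - x) by ring.
  by rewrite absB_lt ?h1 ?h2 ?leq_maxl ?leq_maxr.
by move: xV; rewrite (subr0_eq xl) lV.
Qed.

Hypothesis cF : abs_complete absF.

(** If x is not in V, its distance to V bounds c in terms of [c *: x + y]. Along a Cauchy sequence
    the coefficients of x are therefore Cauchy in F, and so the components in V are Cauchy too. *)
Lemma complete_subspace_adjoin (V : {vspace E}) (x : E) :
  complete_subspace V -> complete_subspace (<[x]> + V).
Proof.
move=> cV; have [xV|xV] := boolP (x \in V).
  suff -> : (<[x]> + V)%VS = V by [].
  by apply/addv_idPr; rewrite -memvE.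
have [delta d0 hd] := complete_subspace_dist cV xV.
have coef_le (c : F) y : y \in V -> absF c * delta <= absE (c *: x + y).
  move=> yV; have [->|c0] := eqVneq c 0.
    by rewrite -(extE.2 0) scale0r (abs0 nE) mul0r abs_ge0.
  (* Dividing by c reduces to the coefficient 1, where [hd] applies. *)
  rewrite -[y](scalerKV c0) -scalerDr abs_scale ler_wpM2l ?hd ?memvZ //.
  by rewrite -extE.2 abs_ge0.
move=> u cu uV.
have /choice[w hw] m : exists w : F * E, w.2 \in V /\ u m = w.1 *: x + w.2.
  have /memv_addP[_ /vlineP[c ->] [y yV ->]] := uV m.
  by exists (c, y).
have [c /(abs_cvgP nE) hc] : exists c : F, abs_cvg absE (fun m => (w m).1%:A) c%:A.
  have [|c hc] := cF (u := fun m => (w m).1); last first.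
    by exists c; move: hc; rewrite /abs_cvg; under eq_fun do rewrite -extE.2 scalerBl.
  move=> eps e0; have [N hN] := cu _ (mulr_gt0 e0 d0); exists N => m k Nm Nk.
  rewrite -(ltr_pM2r d0); apply: le_lt_trans (hN m k Nm Nk).
  have [[wm um] [wk uk]] := (hw m, hw k).
  apply: le_trans (coef_le _ _ (memvB wm wk)) _.
  by rewrite um uk opprD addrACA scalerBl.
have hcx : abs_cvg absE (fun m => (w m).1 *: x) (c *: x).
  apply/abs_cvgP => // eps e0.
  have x0 : 0 < absE x.
    by rewrite abs_gt0 //; apply: contraNneq xV => ->; rewrite mem0v.
  have [N hN] := hc _ (divr_gt0 e0 x0); exists N => m Nm.
  by rewrite -scalerBl abs_scale -extE.2 scalerBl -ltr_pdivlMr ?hN.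
have [||l lV /(abs_cvgP nE) hl] := cV (fun m => (w m).2).
- move=> eps e0; have [N1 h1] := cu _ e0.
  have [N2 h2] := abs_cvg_cauchy nE hcx e0.
  exists (maxn N1 N2) => m k; rewrite !geq_max => /andP[a1 a2] /andP[b1 b2].
  have -> : (w m).2 - (w k).2 = (u m - u k) - ((w m).1 *: x - (w k).1 *: x).
    by rewrite (hw m).2 (hw k).2 opprD addrACA [RHS]addrAC subrr add0r.
  by rewrite absB_lt ?h1 ?h2.
- by move=> m; case: (hw m).
exists (c *: x + l); first by rewrite memv_add ?memvZ ?memv_line.
apply/abs_cvgP => // eps e0; have [N1 h1] := hl _ e0.
have [N2 h2] := (abs_cvgP nE _ _).1 hcx _ e0.
exists (maxn N1 N2) => m; rewrite geq_max => /andP[a1 a2].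
by rewrite (hw m).2 opprD addrACA absD_lt ?h1 ?h2.
Qed.

Lemma complete_extension : abs_complete absE.
Proof.
have cspan (s : seq E) : complete_subspace (span s).
  elim: s => [|x s IHs]; last by rewrite span_cons; apply: complete_subspace_adjoin.
  rewrite span_nil => u _ u0; exists 0; first exact: mem0v.
  apply/abs_cvgP => // eps e0; exists 0%N => m _.
  by move: (u0 m); rewrite memv0 => /eqP ->; rewrite subrr abs0.
move=> u cu; have [|l _ hl] := cspan (vbasis {:E}) u cu; last by exists l.
by move=> m; rewrite (span_basis (vbasisP _)) memvf.
Qed.

End Completeness.

(** * Splitting fields *)

(** A nonconstant divisor of least size has no proper nonconstant divisor. *)
Lemma irreducible_divisor (F : fieldType) (q : {poly F}) : (1 < size q)%N ->
  exists2 r : {poly F}, r %| q & irreducible_poly r.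
Proof.
move=> q1; pose P m := `[< exists r : {poly F}, [/\ size r = m, (1 < m)%N & r %| q] >].
have exP : exists m, P m by exists (size q); apply/asboolP; exists q; rewrite dvdpp.
case: (ex_minnP exP) => m /asboolP[r [rm m1 rq]] mmin; exists r => //.
split=> [|t t1 tr]; first by rewrite rm.
have r0 : r != 0 by rewrite -size_poly_gt0 rm ltnW.
rewrite -dvdp_size_eqp // eqn_leq dvdp_leq //= rm mmin //.
apply/asboolP; exists t; split=> //; last exact: dvdp_trans rq.
by rewrite ltn_neqAle eq_sym t1 size_poly_gt0 (dvdpN0 tr).
Qed.

(** Induction on the degree: adjoin a root of an irreducible factor and split the cofactor. Working
    up to associates avoids following the leading coefficient through the tower. *)
Lemma splitting_extension (F : fieldType) (q : {poly F}) : q != 0 ->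
  exists (L : fieldExtType F) (s : seq L),
    map_poly (in_alg L) q %= \prod_(z <- s) ('X - z%:P).
Proof.
have [m] := ubnP (size q); elim: m => // m IHm in F q * => qm q0.
have [q1|q1] := leqP (size q) 1.
  exists F^o, [::].
  by rewrite big_nil -size_poly_eq1 size_map_poly eqn_leq q1 size_poly_gt0.
have [r rq irr_r] := irreducible_divisor q1.
have [K _ [x rx _]] := irredp_FAdjoin irr_r.
have /factor_theorem[t Dq] : root (map_poly (in_alg K) q) x.
  by move: rq; rewrite -(dvdp_map (in_alg K)) => /dvdpP[u ->]; rewrite rootM rx orbT.
have t0 : t != 0.
  by apply: contra_neq q0 => t0; apply/eqP; rewrite -(map_poly_eq0 (in_alg K)) Dq t0 mul0r.
have [||L [s Ds]] := IHm K t => //.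
  have := size_map_poly (in_alg K) q.
  rewrite Dq size_Mmonic ?monicXsubC // size_XsubC addn2 /= => sq.
  by rewrite -ltnS sq.
(* [baseFieldType L] is L regarded as an extension of F instead of K. *)
exists (baseFieldType L), (x%:A :: s : seq L).
have -> : map_poly (in_alg (baseFieldType L)) q =
          map_poly (in_alg L) (map_poly (in_alg K) q) :> {poly L}.
  rewrite -map_poly_comp; apply: eq_map_poly => a /=.
  by rewrite baseField_scaleE.
rewrite Dq rmorphM rmorphB /= map_polyX map_polyC /= big_cons mulrC.
by rewrite eqp_mull.
Qed.

(** * Extension of absolute values *)

Lemma expr_small (R : realType) (z eps : R) : 0 <= z < 1 -> 0 < eps ->
  exists N : nat, forall m, (N <= m)%N -> z ^+ m < eps.
Proof.
move=> /andP[z0 z1] e0; have /cvg_expr/cvgr0Pnorm_lt : `|z| < 1 by rewrite ger0_norm.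
move=> /(_ _ e0)[N _ hN]; exists N => m Nm.
by have := hN m Nm; rewrite /= ger0_norm ?exprn_ge0.
Qed.

(** Used once for each factor, this gives submultiplicativity of norms defined as infima. *)
Lemma le_mul_inf (R : realType) (S : set R) (k z : R) : S !=set0 -> 0 <= k ->
  (forall y, S y -> 0 <= y) -> (forall y, S y -> z <= k * y) -> z <= k * inf S.
Proof.
move=> S0 k0 Sge0 h; have [k_eq0|kn0] := eqVneq k 0.
  by case: S0 => y /h; rewrite k_eq0 !mul0r.
have kp : 0 < k by rewrite lt_def kn0.
rewrite mulrC -ler_pdivrMr //; apply: lb_le_inf => // y Sy.
by rewrite ler_pdivrMr // mulrC h.
Qed.

Section AlgebraNorms.
Variables (R : realType) (F : fieldType) (E : fieldExtType F) (absF : F -> R).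
Hypothesis nF : nonarch_absval absF.

(** The inequality on scalars is enough: applied to c and to 1/c, together with f(1) = 1 and
    submultiplicativity, it forces equality. *)
Definition algebra_norm (f : E -> R) : Prop :=
  [/\ forall x, 0 <= f x,
      forall x y, f (x + y) <= Num.max (f x) (f y),
      forall x y, f (x * y) <= f x * f y,
      f 1 = 1
    & forall c : F, f c%:A <= absF c].

(* The largest entry of the matrix of multiplication by x; over a
   nonarchimedean field this matrix norm is submultiplicative. *)
Lemma algebra_norm_exists : exists f, algebra_norm f.
Proof.
pose b := vbasis {:E}; pose n : nat := \dim {:E}.
pose ent (x : E) (ij : 'I_n * 'I_n) := absF (coord b ij.1 (x * b`_ij.2)).
pose f (x : E) := \big[Num.max/0]_ij ent x ij.
have entf (x : E) (i j : 'I_n) : absF (coord b i (x * b`_j)) <= f x.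
  exact: (le_bigmax 0 (ent x) (i, j)).
have fge0 x : 0 <= f x by exact: bigmax_ge_id.
have f_le (x : E) M : 0 <= M -> (forall i j : 'I_n, absF (coord b i (x * b`_j)) <= M) -> f x <= M.
  by move=> M0 h; apply: bigmax_le => // -[i j] _; apply: h.
have freeb : free b := basis_free (vbasisP _).
have coord_scal (c : F) (i j : 'I_n) : coord b i (c%:A * b`_j) = c * (i == j)%:R.
  by rewrite mulr_algl linearZ /= coord_free // eq_sym.
have fA (c : F) : f c%:A <= absF c.
  apply: f_le => [|i j]; first exact: abs_ge0.
  rewrite coord_scal absM //; case: (i == j).
    by rewrite abs1 // mulr1.
  by rewrite abs0 // mulr0 abs_ge0.
exists f; split=> //.
- move=> x y; apply: f_le => [|i j]; first by rewrite le_max fge0.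
  rewrite mulrDl linearD /=; have [_ _ _ ultra] := nF.
  by apply: le_trans (ultra _ _) _; rewrite le_max2 ?entf.
- move=> x y; apply: f_le => [|i j]; first by rewrite mulr_ge0.
  rewrite -mulrA [y * _](coord_vbasis (memvf _)) mulr_sumr linear_sum /=.
  apply: abs_sum_le => // [|k _]; first by rewrite mulr_ge0.
  by rewrite -scalerAr linearZ /= absM // mulrC ler_pM ?abs_ge0 ?entf.
apply/le_anti; have := fA 1; rewrite scale1r (abs1 nF) => -> /=.
have n0 : (0 < n)%N by exact: (adim_gt0 (aspacef E)).
have := entf 1 (Ordinal n0) (Ordinal n0).
by rewrite -(scale1r (1 : E)) coord_scal eqxx mulr1 abs1.
Qed.

(** Zorn's lemma, a chain being bounded below by its pointwise infimum. *)
Lemma minimal_algebra_norm : exists2 f, algebra_norm f &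
  forall h, algebra_norm h -> (forall x, h x <= f x) -> h = f.
Proof.
pose T := {f : E -> R | algebra_norm f}.
(* The pointwise order is reversed, so that a maximal element is a minimal norm. *)
pose le (f h : T) := `[< forall x, proj1_sig h x <= proj1_sig f x >].
have T_inj (f h : T) : proj1_sig f = proj1_sig h -> f = h.
  case: f h => [f Pf] [h Ph] /= fh; subst h; congr exist; exact: Prop_irrelevance.
have [||||[f Pf] fmin] := @Zorn T le.
- by move=> f; apply/asboolP.
- move=> f h k /asboolP fh /asboolP hk; apply/asboolP => x.
  exact: le_trans (hk x) (fh x).
- move=> f h /asboolP fh /asboolP hf; apply: T_inj; apply/funext => x.
  by apply/le_anti; rewrite fh hf.
- move=> A totA; have [/eqP ->|/set0P[f0 Af0]] := boolP (A == set0).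
    by have [f Pf] := algebra_norm_exists; exists (exist _ f Pf).
  pose S x := [set proj1_sig f x | f in A].
  have Sge0 x y : S x y -> 0 <= y by case=> -[f [f_ge0 ? ? ? ?]] _ <-; apply: f_ge0.
  have Sne x : S x !=set0 by exists (proj1_sig f0 x); exists f0.
  have Slb x : has_lbound (S x) by exists 0 => y /Sge0.
  pose h x := inf (S x).
  have h_le f x : A f -> h x <= proj1_sig f x.
    by move=> Af; apply: ge_inf => //; exists f.
  (* A single norm of the chain lies below any two given ones; this carries the ultrametric
     inequality and submultiplicativity over to the infimum. *)
  have common (f k : T) : A f -> A k -> exists2 m : T, A m &
      forall x, proj1_sig m x <= proj1_sig f x /\ proj1_sig m x <= proj1_sig k x.
    move=> Af Ak; have [/asboolP fk|/asboolP kf] := totA f k Af Ak.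
      by exists k => // x; rewrite fk.
    by exists f => // x; rewrite kf.
  have h_ge0 x : 0 <= h x by apply: lb_le_inf => // y /Sge0.
  suff Ph : algebra_norm h.
    by exists (exist _ h Ph) => f Af; apply/asboolP => x; apply: h_le.
  split=> //.
  + move=> x y; rewrite leNgt gt_max; apply/negP => /andP[].
    move=> /(inf_lt (Sne x))[_ [f Af <-]] fx /(inf_lt (Sne y))[_ [k Ak <-]] ky.
    have [m Am hm] := common _ _ Af Ak.
    have [_ ultra _ _ _] := proj2_sig m.
    have := le_trans (h_le m (x + y) Am) (ultra x y).
    rewrite leNgt => /negP; apply; rewrite gt_max.
    by rewrite (le_lt_trans (hm x).1 fx) (le_lt_trans (hm y).2 ky).
  + move=> x y; rewrite [leRHS]mulrC; apply: le_mul_inf => // [y' /Sge0|_ [f Af <-]] //.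
    have [fge0 _ _ _ _] := proj2_sig f.
    rewrite [leRHS]mulrC; apply: le_mul_inf => // [y' /Sge0|_ [k Ak <-]] //.
    have [kge0 _ _ _ _] := proj2_sig k.
    have [m Am hm] := common _ _ Af Ak; have [mge0 _ subm _ _] := proj2_sig m.
    apply: le_trans (h_le m _ Am) _; apply: le_trans (subm x y) _.
    by rewrite ler_pM ?(hm x).1 ?(hm y).2.
  + apply/le_anti/andP; split.
      by apply: le_trans (h_le f0 1 Af0) _; have [_ _ _ -> _] := proj2_sig f0.
    by apply: lb_le_inf => // _ [f Af <-]; have [_ _ _ -> _] := proj2_sig f.
  + move=> c; apply: le_trans (h_le f0 _ Af0) _.
    by have [_ _ _ _ hc] := proj2_sig f0.
exists f => // h Ph hf.
by have /(congr1 (@proj1_sig _ _)) := fmin (exist _ h Ph) (asboolT hf).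
Qed.

Section ReducedNorm.
Variables (f : E -> R) (Pf : algebra_norm f).

Let f_ge0 x : 0 <= f x. Proof. by case: Pf. Qed.
Let f_sub x y : f (x * y) <= f x * f y. Proof. by case: Pf. Qed.
Let f_one : f 1 = 1. Proof. by case: Pf. Qed.
Let f_zero : f 0 = 0.
Proof.
apply/le_anti; rewrite f_ge0 andbT; case: Pf => _ _ _ _ /(_ 0).
by rewrite scale0r (abs0 nF).
Qed.

Let f_sum_le (I : Type) (s : seq I) (P : pred I) (u : I -> E) M :
  0 <= M -> (forall i, P i -> f (u i) <= M) -> f (\sum_(i <- s | P i) u i) <= M.
Proof.
move=> M0 hu; elim/big_rec: _ => [|i x Pi hx]; first by rewrite f_zero.
by case: Pf => _ h _ _ _; apply: le_trans (h _ _) _; rewrite ge_max hu.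
Qed.

Let f_sum_lt (I : Type) (s : seq I) (P : pred I) (u : I -> E) M :
  0 < M -> (forall i, P i -> f (u i) < M) -> f (\sum_(i <- s | P i) u i) < M.
Proof.
move=> M0 hu; elim/big_rec: _ => [|i x Pi hx]; first by rewrite f_zero.
by case: Pf => _ h _ _ _; apply: le_lt_trans (h _ _) _; rewrite gt_max hu.
Qed.

Lemma algebra_norm_gt0 x : x != 0 -> 0 < f x.
Proof.
move=> x0; rewrite lt_def f_ge0 andbT; apply/eqP => fx.
have := f_sub x x^-1; rewrite divff // f_one fx mul0r.
by rewrite leNgt ltr01.
Qed.

Variables (a : E) (r : R).
Hypotheses (a0 : a != 0) (r0 : 0 < r).
Let rX_ge0 i : 0 <= r ^+ i. Proof. by rewrite exprn_ge0 ?ltW. Qed.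

Definition gauss_norm (c : {poly E}) : R :=
  \big[Num.max/0]_(i < size c) (f c`_i * r ^+ i).

(* The quotient norm on E = E[X] / (X - a), where X is given norm r. *)
Definition reduced_norm (x : E) : R :=
  inf [set gauss_norm c | c in [set c : {poly E} | c.[a] = x]].

Let gauss_ge0 c : 0 <= gauss_norm c. Proof. exact: bigmax_ge_id. Qed.

Let coef_gauss (c : {poly E}) i : f c`_i * r ^+ i <= gauss_norm c.
Proof.
have [ic|ci] := ltnP i (size c); first 
  exact: (le_bigmax 0 (fun i : 'I_(size c) => f c`_i * r ^+ i) (Ordinal ic)).
by rewrite nth_default // f_zero mul0r.
Qed.

Let gauss_le (c : {poly E}) M : 0 <= M -> (forall i, f c`_i * r ^+ i <= M) -> gauss_norm c <= M.
Proof. by move=> M0 h; apply: bigmax_le. Qed.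

Let gaussD c d : gauss_norm (c + d) <= Num.max (gauss_norm c) (gauss_norm d).
Proof.
apply: gauss_le => [|i]; first by rewrite le_max gauss_ge0.
have [_ ultra _ _ _] := Pf; rewrite coefD.
apply: le_trans (ler_wpM2r _ (ultra _ _)) _; first by [].
rewrite maxr_pMl //.
by apply: le_max2; apply: coef_gauss.
Qed.

Let gaussM c d : gauss_norm (c * d) <= gauss_norm c * gauss_norm d.
Proof.
apply: gauss_le => [|i]; first by rewrite mulr_ge0.
rewrite coefM -ler_pdivlMr ?exprn_gt0 //; apply: f_sum_le => [|j _].
  by rewrite !mulr_ge0 ?invr_ge0.
rewrite ler_pdivlMr ?exprn_gt0 //; apply: le_trans (ler_wpM2r _ (f_sub _ _)) _; first by [].
have -> : r ^+ i = r ^+ j * r ^+ (i - j) by rewrite -exprD subnKC // -ltnS.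
by rewrite mulrACA ler_pM ?coef_gauss ?mulr_ge0.
Qed.

Let gaussC x : gauss_norm x%:P <= f x.
Proof.
apply: gauss_le => // i; rewrite coefC; case: eqP => [->|_]; first by rewrite mulr1.
by rewrite f_zero mul0r.
Qed.

Let gaussX : gauss_norm 'X <= r.
Proof.
apply: gauss_le => [|i]; first exact: ltW.
rewrite coefX; case: eqP => [->|_]; first by rewrite f_one mul1r.
by rewrite f_zero mul0r ltW.
Qed.

Let Sne x : [set gauss_norm c | c in [set c : {poly E} | c.[a] = x]] !=set0.
Proof. by exists (gauss_norm x%:P); exists x%:P => //=; rewrite hornerC. Qed.

Let red_le c : reduced_norm c.[a] <= gauss_norm c.
Proof. by apply: ge_inf; [exists 0 => _ [d _ <-] | exists c]. Qed.

Lemma reduced_norm_le x : reduced_norm x <= f x.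
Proof. by have := red_le x%:P; rewrite hornerC => /le_trans; apply. Qed.

Lemma reduced_norm_gen : reduced_norm a <= r.
Proof. by have := red_le 'X; rewrite hornerX => /le_trans; apply. Qed.

(* If 1 = c(a) with |c| < 1, then multiplying by a^-n bounds f(a^-n) r^n by
   the preceding values of this sequence. *)
Lemma small_one_bounded (c : {poly E}) : c.[a] = 1 -> gauss_norm c < 1 ->
  exists C, forall n, f (a ^- n) * r ^+ n <= C.
Proof.
move=> ca c1; pose B n := f (a ^- n) * r ^+ n.
have B0 n : 0 < B n by rewrite mulr_gt0 ?exprn_gt0 // algebra_norm_gt0 ?invr_eq0 ?expf_neq0.
pose C := \sum_(j < size c) B j; exists C => n; rewrite -/(B n).
have [m] := ubnP n; elim: m => // m IHm in n *; rewrite ltnS => nm.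
have [nc|cn] := ltnP n (size c).
  rewrite /C (bigD1 (Ordinal nc)) //= lerDl sumr_ge0 // => j _; exact: ltW.
rewrite leNgt; apply/negP => CB.
have : f (a ^- n) < f (a ^- n).
  rewrite {1}[a ^- n](_ : _ = \sum_(i < size c) c`_i * a ^- (n - i)); last first.
    rewrite -[LHS]mul1r -ca horner_coef mulr_suml; apply: eq_bigr => i _.
    have ni : n = (n - i + i)%N by rewrite subnK // (leq_trans (ltnW (ltn_ord i))).
    by rewrite {1}ni exprD invfM [X in _ * X]mulrC mulrA mulfK ?expf_neq0.
  apply: f_sum_lt => [|i _]; first by rewrite algebra_norm_gt0 ?invr_eq0 ?expf_neq0.
  have rn : 0 < r ^+ n by rewrite exprn_gt0.
  rewrite -(ltr_pM2r rn) -/(B n).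
  have ni : (i <= n)%N by rewrite (leq_trans (ltnW (ltn_ord i))).
  apply: (@le_lt_trans _ _ (f c`_i * r ^+ i * B (n - i)%N)).
    rewrite /B mulrACA -exprD subnKC // ler_wpM2r ?f_sub //; exact: ltW.
  have ci : f c`_i * r ^+ i < 1 by apply: le_lt_trans c1.
  (* The term i = 0 involves [B n] itself, and is smaller because its coefficient has norm below 1.
     For i > 0 the induction gives [B (n - i) <= C], and [C < B n] by assumption. *)
  have [i0|i0] := posnP i.
    by rewrite i0 in ci *; rewrite subn0 -[ltRHS]mul1r ltr_pM2r.
  apply: le_lt_trans CB; rewrite -[leRHS]mul1r ler_pM //; first 1 last.
  - exact: ltW.
  - exact: ltW.
  - apply: IHm; rewrite ltn_subLR //; apply: leq_ltn_trans nm _.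
    by rewrite -[X in (X < _)%N]add0n ltn_add2r.
  - by rewrite mulr_ge0 // exprn_ge0 // ltW.
by rewrite ltxx.
Qed.

(** The unboundedness excludes representatives of 1 of Gauss norm below 1; the other axioms are
    inherited from the Gauss norm and from f. *)
Lemma reduced_algebra_norm :
  (forall C, exists n, C < f (a ^- n) * r ^+ n) -> algebra_norm reduced_norm.
Proof.
move=> unb.
have red_ge0 x : 0 <= reduced_norm x by apply: lb_le_inf => // _ [c _ <-].
split=> //.
- move=> x y; rewrite leNgt gt_max; apply/negP => /andP[].
  move=> /(inf_lt (Sne x))[_ [c /= cx <-]] hc /(inf_lt (Sne y))[_ [d /= dy <-]] hd.
  have := le_trans (red_le (c + d)) (gaussD c d).
  by rewrite hornerD cx dy leNgt gt_max hc hd.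
- move=> x y; rewrite [leRHS]mulrC; apply: le_mul_inf => // [_ [c _ <-]|_ [c /= cx <-]] //.
  rewrite [leRHS]mulrC; apply: le_mul_inf => // [_ [d _ <-]|_ [d /= dy <-]] //.
  have := le_trans (red_le (c * d)) (gaussM c d).
  by rewrite hornerM cx dy.
- apply/le_anti/andP; split; first by have := reduced_norm_le 1; rewrite f_one.
  rewrite leNgt; apply/negP => /(inf_lt (Sne 1))[_ [c /= ca <-]] c1.
  have [C hC] := small_one_bounded ca c1; have [n hn] := unb C.
  by have := lt_le_trans hn (hC n); rewrite ltxx.
- move=> c; apply: le_trans (reduced_norm_le _) _; by case: Pf.
Qed.

End ReducedNorm.

Theorem absval_extension_exists : exists absE : E -> R, absval_extends absF absE.
Proof.
have [f Pf fmin] := minimal_algebra_norm; exists f.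
have [f_ge0 f_ultra f_sub f_one fA] := Pf.
(* Were the sequence unbounded, minimality would make the reduced norm equal to f, although its
   value at a is at most r < f(a). *)
have bounded a r : a != 0 -> 0 < r -> r < f a ->
    exists C, forall n, f (a ^- n) * r ^+ n <= C.
  move=> a0 r0 ra; apply: contrapT => hn.
  have Pr : algebra_norm (reduced_norm f a r).
    apply: reduced_algebra_norm => // C; apply: contrapT => hC; apply: hn.
    by exists C => n; rewrite leNgt; apply/negP => h; apply: hC; exists n.
  have := fmin _ Pr (reduced_norm_le Pf a r) => /(congr1 (fun h => h a)) ha.
  by have := reduced_norm_gen Pf a r0; rewrite ha leNgt ra.
have f_inv_le a : a != 0 -> f a * f a^-1 <= 1.
  move=> a0; rewrite leNgt; apply/negP => q1; set q := _ * _ in q1.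
  have fa : 0 < f a by apply: algebra_norm_gt0.
  have fb : 0 < f a^-1 by rewrite algebra_norm_gt0 ?invr_eq0.
  pose u := q^-1; have u1 : u < 1 by rewrite invf_lt1 // (lt_trans ltr01).
  have u0 : 0 < u by rewrite invr_gt0 (lt_trans ltr01).
  (* The midpoint of 1 and 1/q satisfies t < 1 and q t^2 = (q + 1)^2 / (4 q) > 1. *)
  pose t := (1 + u) / 2; have t0 : 0 < t by rewrite /t; lra.
  have t1 : t < 1 by rewrite /t; lra.
  have [|C hC] := bounded a (f a * t) a0 (mulr_gt0 fa t0).
    by rewrite -[ltRHS]mulr1 ltr_pM2l.
  have a'0 : a^-1 != 0 by rewrite invr_eq0.
  have [|D hD] := bounded a^-1 (f a^-1 * t) a'0 (mulr_gt0 fb t0).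
    by rewrite -[ltRHS]mulr1 ltr_pM2l.
  pose z := (q * t ^+ 2)^-1.
  have qt1 : 1 < q * t ^+ 2.
    rewrite -ltr_pdivrMl ?(lt_trans ltr01) // mulr1 -/u /t; nra.
  have qt0 : 0 < q * t ^+ 2 := lt_trans ltr01 qt1.
  have z1 : 0 <= z < 1 by rewrite invr_ge0 invf_lt1 // qt1 ltW.
  have CD0 : 0 < C * D.
    have := hC 0%N; have := hD 0%N.
    rewrite !expr0 !invr1 f_one !mulr1 => hD0 hC0.
    by rewrite mulr_gt0 // (lt_le_trans ltr01).
  have CDi : 0 < (C * D)^-1 by rewrite invr_gt0.
  have [N /(_ _ (leqnn N))] := expr_small z1 CDi.
  rewrite exprVn ltf_pV2 ?posrE ?exprn_gt0 //.
  apply/negP; rewrite -leNgt.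
  (* The product of the two bounded sequences at N is f(a^-N) f(a^N) (q t^2)^N, and f(a^-N) f(a^N)
     >= f(1) = 1; so it outgrows [C * D]. *)
  apply: le_trans (ler_pM _ _ (hC N) (hD N)); try by
    rewrite mulr_ge0 // exprn_ge0 // mulr_ge0 // ltW.
  rewrite exprVn invrK [leRHS]mulrACA -exprMn.
  rewrite (_ : f a * t * (f a^-1 * t) = q * t ^+ 2); last by rewrite /q; ring.
  rewrite -[leLHS]mul1r ler_wpM2r ?(exprn_ge0 _ (ltW qt0)) //.
  by have := f_sub (a ^- N) (a ^+ N); rewrite mulVf ?expf_neq0 // f_one.
have fV a : a != 0 -> f a^-1 = (f a)^-1.
  move=> a0; have fa : f a != 0 by rewrite gt_eqF ?algebra_norm_gt0.
  apply: (mulfI fa); rewrite divff //; apply/le_anti; rewrite f_inv_le //=.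
  by have := f_sub a a^-1; rewrite divff // f_one.
have f0 : f 0 = 0.
  by apply/le_anti; rewrite f_ge0 andbT -(abs0 nF) -(scale0r (1 : E)) fA.
split; first split=> //.
- move=> x; split=> [fx|-> //]; apply/eqP/negPn/negP => x0.
  by have := algebra_norm_gt0 Pf x0; rewrite fx ltxx.
- move=> x y; have [->|y0] := eqVneq y 0; first by rewrite mulr0 f0 mulr0.
  apply/le_anti; rewrite f_sub /=.
  have fy := algebra_norm_gt0 Pf y0.
  (* f(x) = f(x y y^-1) <= f(x y) / f(y). *)
  by rewrite -ler_pdivlMr // -fV // -[X in f X <= _](mulfK y0) f_sub.
move=> c; have [->|c0] := eqVneq c 0; first by rewrite scale0r f0 abs0.
apply/le_anti; rewrite fA /=.
have cA0 : c%:A != 0 :> E by rewrite scaler_eq0 oner_eq0 orbF.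
have cAV : (c^-1)%:A = c%:A^-1 :> E by exact: (fmorphV (in_alg E)).
have := fA c^-1; rewrite absV // cAV fV // lef_pV2 ?posrE //.
  exact: algebra_norm_gt0.
by rewrite abs_gt0.
Qed.

End AlgebraNorms.

(** * Newton iteration *)

(** Consecutive terms have the ratio P^-1 r^m with m = p^k (p - 1), which is at most P as soon as
    r^m < P^2. *)
Lemma term_bound_small (R : realType) (p : nat) (P r eps : R) : (1 < p)%N ->
  0 < P < 1 -> 0 < r < 1 -> 0 < eps ->
  exists N : nat, forall k, (N <= k)%N -> P ^- k * r ^+ (p ^ k) < eps.
Proof.
move=> p1 /andP[P0 P1] /andP[r0 r1] e0; pose t k := P ^- k * r ^+ (p ^ k).
have t0 k : 0 < t k by rewrite mulr_gt0 ?invr_gt0 ?exprn_gt0.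
have [||N1 hN1] := @expr_small _ r (P ^+ 2); [by rewrite ltW | by rewrite exprn_gt0 |].
have tS k : (N1 <= k)%N -> t k.+1 <= P * t k.
  move=> Nk; rewrite /t; have -> : (p ^ k.+1 = p ^ k + (p ^ k * p.-1))%N.
    by rewrite -mulnS prednK ?expnSr // ltnW.
  rewrite exprD; set m := (_ * _)%N.
  have km : (N1 <= m)%N.
    apply: leq_trans Nk (leq_trans (ltnW (ltn_expl k p1)) _).
    by rewrite /m leq_pmulr // -ltnS prednK // ltnW.
  have -> : P * (P ^- k * r ^+ (p ^ k)) = P ^- k.+1 * (r ^+ (p ^ k) * P ^+ 2).
    by rewrite exprS; field; rewrite expf_neq0 ?gt_eqF.
  by rewrite ler_pM2l ?invr_gt0 ?exprn_gt0 // ler_pM2l ?exprn_gt0 // ltW ?hN1.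
have tD j : t (N1 + j)%N <= P ^+ j * t N1.
  elim: j => [|j IHj]; first by rewrite addn0 mul1r.
  rewrite addnS; apply: le_trans (tS _ (leq_addr _ _)) _.
  by rewrite exprS -mulrA ler_pM2l.
have [||N2 hN2] := @expr_small _ P (eps / t N1); [by rewrite ltW | by rewrite divr_gt0 |].
exists (N1 + N2)%N => k Nk; have Nk1 : (N1 <= k)%N by lia.
rewrite -/(t k) -(subnKC Nk1); apply: le_lt_trans (tD _) _.
by rewrite -ltr_pdivlMr ?hN2 //; lia.
Qed.

(** Beyond some index, a step governed by t puts u below eps, and later steps keep it there; without
    such a step u decays geometrically. *)
Lemma contraction_to0 (R : realType) (r C : R) (u t : nat -> R) :
  0 <= r < 1 -> (forall m, u m <= C) ->
  (forall m, u m.+1 <= Num.max (r * u m) (t m)) ->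
  (forall eps, 0 < eps -> exists N : nat, forall m, (N <= m)%N -> t m < eps) ->
  forall eps, 0 < eps -> exists N : nat, forall m, (N <= m)%N -> u m < eps.
Proof.
move=> /andP[r0 r1] uC uS ht eps e0; have [N hN] := ht _ e0.
have [M C0 CM] : exists2 M : R, 0 < M & C <= M.
  by exists (Num.max 1 C); rewrite ?lt_max ?ltr01 // le_max lexx orbT.
have uN j : u (N + j)%N < eps \/ u (N + j)%N <= r ^+ j * M.
  elim: j => [|j IHj]; first by right; rewrite mul1r (le_trans (uC _)).
  have := uS (N + j)%N; rewrite addnS le_max => /orP[h|h]; last first.
    by left; apply: le_lt_trans h (hN _ (leq_addr _ _)).
  case: IHj => hj; [left|right].
    apply: le_lt_trans h _; have [uj|uj] := ltP 0 (u (N + j)%N).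
      by apply: le_lt_trans hj; rewrite ger_pMl // ltW.
    by apply: le_lt_trans e0; rewrite mulr_ge0_le0.
  by apply: le_trans h _; rewrite exprS -mulrA ler_wpM2l.
have [||N2 hN2] := @expr_small _ r (eps / M); [by rewrite r0 | by rewrite divr_gt0 |].
exists (N + N2)%N => m Nm; have Nm1 : (N <= m)%N by lia.
rewrite -(subnKC Nm1); case: (uN (m - N)%N) => // /le_lt_trans; apply.
by rewrite -ltr_pdivlMr ?hN2 //; lia.
Qed.

Section Newton.
Variables (R : realType) (E : fieldType) (abs : E -> R).
Hypotheses (nE : nonarch_absval abs) (cE : abs_complete abs).

(** In an ultrametric a telescoping sum is no larger than its largest step. *)
Lemma abs_cauchy_step (u : nat -> E) :
  (forall eps, 0 < eps -> exists N : nat, forall m, (N <= m)%N -> abs (u m.+1 - u m) < eps) ->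
  abs_cauchy abs u.
Proof.
move=> h eps e0; have [N hN] := h _ e0; exists N => m k Nm Nk.
have near j : abs (u (N + j)%N - u N) < eps.
  elim: j => [|j IHj]; first by rewrite addn0 subrr abs0.
  rewrite addnS (_ : _ - _ = (u (N + j).+1 - u (N + j)%N) + (u (N + j)%N - u N)); last by ring.
  by rewrite absD_lt // hN // leq_addr.
have -> : u m - u k = (u m - u N) - (u k - u N) by ring.
by rewrite -(subnKC Nm) -(subnKC Nk) absB_lt.
Qed.

Variables (p : nat) (r : R).
Local Notation P := (abs p%:R).
Hypotheses (p1 : (1 < p)%N) (P01 : 0 < P < 1) (r01 : 0 < r < 1).

Let P0 : 0 < P. Proof. by case/andP: P01. Qed.
Let P1 : P < 1. Proof. by case/andP: P01. Qed.
Let r0 : 0 < r. Proof. by case/andP: r01. Qed.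
Let r1 : r < 1. Proof. by case/andP: r01. Qed.
Let Pr_le : P * r <= r. Proof. by rewrite ger_pMl // ltW. Qed.
Let Pr_gt0 : 0 < P * r. Proof. exact: mulr_gt0. Qed.
Let p_neq0 : p%:R != 0 :> E. Proof. by rewrite -(abs_gt0 nE). Qed.

Definition log_partial (a : nat -> E) (M : nat) (x : E) : E :=
  \sum_(k < M) a k / p%:R ^+ k * x ^+ (p ^ k)%N.

Lemma abs_subX_le (x y : E) m : abs x <= 1 -> abs y <= 1 ->
  abs (x ^+ m - y ^+ m) <= abs (x - y).
Proof.
move=> x1 y1; rewrite subrXX (absM nE) ler_piMr ?(abs_ge0 nE) //.
apply: abs_sum_le => // i _; rewrite (absM nE) !(absX nE).
by rewrite mulr_ile1 ?exprn_ge0 ?exprn_ile1 ?(abs_ge0 nE).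
Qed.

(* x^p - y^p = (x - y)(p y^(p-1) + O(x - y)). *)
Lemma frobenius_close (x y : E) : abs x <= r -> abs y <= r -> abs (x - y) <= P * r ->
  abs (x ^+ p - y ^+ p) <= P * r * abs (x - y).
Proof.
move=> xr yr xy; have [x1 y1] := (le_trans xr (ltW r1), le_trans yr (ltW r1)).
rewrite subrXX (absM nE) mulrC ler_wpM2r ?(abs_ge0 nE) //.
have -> : \sum_(i < p) x ^+ (p.-1 - i) * y ^+ i =
    \sum_(i < p) (x ^+ (p.-1 - i) - y ^+ (p.-1 - i)) * y ^+ i + p%:R * y ^+ p.-1.
  have -> : p%:R * y ^+ p.-1 = \sum_(i < p) y ^+ p.-1.
    by rewrite sumr_const card_ord mulr_natl.
  rewrite -big_split /=; apply: eq_bigr => i _.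
  by rewrite mulrBl -exprD subnK ?subrK // -ltnS prednK // ltnW.
apply: absD_le => //.
  apply: abs_sum_le => [||i _] //; first exact: ltW.
  apply: le_trans xy; rewrite (absM nE) (absX nE) -[leRHS]mulr1.
  by rewrite ler_pM ?exprn_ge0 ?exprn_ile1 ?(abs_ge0 nE) ?abs_subX_le.
rewrite (absM nE) (absX nE) ler_pM2l //; have -> : p.-1 = p.-2.+1 by lia.
by rewrite exprS -[leRHS]mulr1 ler_pM ?exprn_ge0 ?exprn_ile1 ?(abs_ge0 nE).
Qed.

Lemma absX_le (x : E) m : (0 < m)%N -> abs x <= r -> abs (x ^+ m) <= r.
Proof.
case: m => // m _ xr; rewrite (absX nE) exprS -[leRHS]mulr1.
by rewrite ler_pM ?exprn_ge0 ?exprn_ile1 ?(abs_ge0 nE) // (le_trans xr) ?ltW.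
Qed.

(** Every p-th power contracts by the factor P r. The resulting P^k will cancel the denominator p^k
    in the term of index k. *)
Lemma frobenius_iter_close (x y : E) k :
  abs x <= r -> abs y <= r -> abs (x - y) <= P * r ->
  abs (x ^+ (p ^ k) - y ^+ (p ^ k)) <= (P * r) ^+ k * abs (x - y).
Proof.
move=> xr yr xy; elim: k => [|k IHk]; first by rewrite mul1r.
have pk0 : (0 < p ^ k)%N by rewrite expn_gt0 ltnW.
have Pr1 : P * r <= 1 by rewrite (le_trans Pr_le) ?ltW.
rewrite expnSr !exprM exprS -mulrA.
apply: le_trans (frobenius_close _ _ _) _; rewrite ?absX_le //.
  apply: le_trans IHk (le_trans _ xy).
  by rewrite ler_piMl ?(abs_ge0 nE) // exprn_ile1 // ltW.
by rewrite ler_pM2l.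
Qed.

Section Coefficients.
Variable a : nat -> E.
Hypotheses (a_le1 : forall k, abs (a k) <= 1) (a0 : abs (a 0%N) = 1).

Let abs_coef k : abs (a k / p%:R ^+ k) <= P ^- k.
Proof. by rewrite (absM nE) (absV nE) (absX nE) ler_piMl ?invr_ge0 ?exprn_ge0 ?(abs_ge0 nE). Qed.

Lemma abs_log_term k (x : E) : abs x <= r ->
  abs (a k / p%:R ^+ k * x ^+ (p ^ k)) <= P ^- k * r ^+ (p ^ k).
Proof.
move=> xr; rewrite (absM nE) (absX nE) ler_pM ?(abs_ge0 nE) ?exprn_ge0 ?(abs_ge0 nE) //.
by rewrite lerXn2r ?nnegrE ?(abs_ge0 nE) ?(ltW r0).
Qed.

(** The terms of index k differ by at most P^-k (P r)^k |x - y| = r^k |x - y|, and k >= 1 once the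
    linear term is removed. *)
Lemma log_partial_close M (x y : E) :
  abs x <= r -> abs y <= r -> abs (x - y) <= P * r ->
  abs (log_partial a M.+1 x - log_partial a M.+1 y - a 0%N * (x - y)) <= r * abs (x - y).
Proof.
move=> xr yr xy; rewrite /log_partial !big_ord_recl /= !expn0 !expr1 invr1 mulr1.
set S1 := \sum_(i < M) _; set S2 := \sum_(i < M) _.
have -> : a 0%N * x + S1 - (a 0%N * y + S2) - a 0%N * (x - y) = S1 - S2 by ring.
rewrite /S1 /S2 -sumrB; apply: abs_sum_le => // [|k _].
  by rewrite mulr_ge0 ?(abs_ge0 nE) ?ltW.
rewrite -mulrBr (absM nE).
apply: le_trans (ler_pM _ _ (abs_coef _) (frobenius_iter_close _ xr yr xy)) _.
- exact: abs_ge0.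
- exact: abs_ge0.
rewrite mulrA exprMn mulKf ?expf_neq0 ?gt_eqF // ler_wpM2r ?(abs_ge0 nE) //=.
by rewrite exprS ger_pMr // exprn_ile1 // ltW.
Qed.

Lemma log_partial_isometry M (x y : E) : (0 < M)%N ->
  abs x <= r -> abs y <= r -> abs (x - y) <= P * r ->
  abs (log_partial a M x - log_partial a M y) = abs (x - y).
Proof.
case: M => // M _ xr yr xy; have [->|nxy] := eqVneq x y; first by rewrite !subrr.
have xy0 : 0 < abs (x - y) by rewrite abs_gt0 // subr_eq0.
have axy : abs (a 0%N * (x - y)) = abs (x - y) by rewrite (absM nE) a0 mul1r.
rewrite -[in RHS]axy; apply: (abs_close nE); rewrite absBC // axy.
apply: le_lt_trans (log_partial_close _ xr yr xy) _.
by rewrite gtr_pMl.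
Qed.

(** For x different from y the partial sums differ by the constant |x - y|, so they cannot both tend
    to 0. *)
Lemma log_zero_unique (x y : E) : abs x <= r -> abs y <= r -> abs (x - y) <= P * r ->
  abs_cvg abs (fun M => log_partial a M x) 0 ->
  abs_cvg abs (fun M => log_partial a M y) 0 -> x = y.
Proof.
move=> xr yr xy /(abs_cvgP nE) hx /(abs_cvgP nE) hy; apply/eqP.
rewrite -subr_eq0 -(abs_eq0 nE) eq_le (abs_ge0 nE) andbT leNgt; apply/negP => xy0.
have [[N1 h1] [N2 h2]] := (hx _ xy0, hy _ xy0); pose M := (maxn N1 N2).+1.
have := @log_partial_isometry M x y isT xr yr xy.
have lt_xy : abs (log_partial a M x - log_partial a M y) < abs (x - y).
  have {}h1 := h1 M (leqW (leq_maxl _ _)); have {}h2 := h2 M (leqW (leq_maxr _ _)).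
  by rewrite !subr0 in h1 h2; rewrite absB_lt.
by move=> h; rewrite h ltxx in lt_xy.
Qed.

(* Newton iteration with the constant slope a_0, one more term of the series
   being taken into account at each step. *)
Lemma log_newton N (x : E) : (0 < N)%N ->
  (forall k, (N <= k)%N -> P ^- k * r ^+ (p ^ k) <= P * r) ->
  abs x <= r -> abs (log_partial a N x) <= P * r ->
  exists y, [/\ abs y <= r, abs (x - y) <= P * r
              & abs_cvg abs (fun M => log_partial a M y) 0].
Proof.
move=> N0 tail xr lx.
pose step m z := z - log_partial a (N + m) z / a 0%N.
pose u := fix u m := if m is m'.+1 then step m' (u m') else x.
pose e m := abs (log_partial a (N + m) (u m)).
have a00 : a 0%N != 0 by rewrite -(abs_gt0 nE) a0.
have NmS m : exists M, (N + m)%N = M.+1 by exists (N + m).-1; lia.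
have uS m : u m.+1 - u m = - (log_partial a (N + m) (u m) / a 0%N).
  by rewrite /= /step addrAC subrr add0r.
have duS m : abs (u m.+1 - u m) = e m.
  by rewrite uS absN // (absM nE) (absV nE) a0 invr1 mulr1.
(* The step cancels the linear part at [u m], leaving only the linearization error, at most
   [r * e m], and the newly added term of index N + m. *)
have eS m : abs (u m) <= r -> abs (u m.+1) <= r -> e m <= P * r ->
    e m.+1 <= Num.max (r * e m) (P ^- (N + m) * r ^+ (p ^ (N + m))).
  move=> um umS em; rewrite {1}/e addnS /log_partial big_ord_recr /= -/(log_partial a (N + m) _).
  have [_ _ _ ultra] := nE; apply: le_trans (ultra _ _) _; apply: le_max2; last first.
    exact: abs_log_term.
  have := @log_partial_close (N + m).-1 (u m.+1) (u m) umS um.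
  rewrite prednK ?addn_gt0 ?N0 // duS => /(_ em); congr (_ <= _); congr abs.
  by rewrite uS; field.
have inv m : abs (u m) <= r /\ e m <= P * r.
  elim: m => [|m [um em]]; first by rewrite /e addn0.
  have umS : abs (u m.+1) <= r.
    rewrite -[u m.+1](subrK (u m)) absD_le // duS; exact: le_trans Pr_le.
  split=> //; apply: le_trans (eS m um umS em) _; rewrite ge_max tail ?leq_addr // andbT.
  by apply: le_trans em; rewrite ler_piMl ?(abs_ge0 nE) ?ltW.
have e_to0 : forall eps, 0 < eps -> exists M : nat, forall m, (M <= m)%N -> e m < eps.
  apply: (@contraction_to0 _ r (P * r) _ (fun m => P ^- (N + m) * r ^+ (p ^ (N + m)))).
  - by rewrite ltW.
  - by move=> m; case: (inv m).
  - by move=> m; case: (inv m) (inv m.+1) => um em [umS _]; apply: eS.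
  - move=> eps e0; have [M hM] := term_bound_small p1 P01 r01 e0.
    by exists M => m Mm; apply: hM; apply: leq_trans Mm (leq_addl _ _).
have [|y /(abs_cvgP nE) uy] := cE (u := u).
  by apply: abs_cauchy_step => eps /e_to0[M hM]; exists M => m /hM; rewrite duS.
have xu m : abs (x - u m) <= P * r.
  elim: m => [|m IHm]; first by rewrite subrr abs0 // ltW.
  have -> : x - u m.+1 = (x - u m) - (u m.+1 - u m) by ring.
  by rewrite absB_le // duS; case: (inv m).
have uyr m : abs (u m - y) <= P * r.
  have [M hM] := uy _ Pr_gt0.
  have -> : u m - y = (x - u M) + (u M - y) - (x - u m) by ring.
  by rewrite absB_le // absD_le // ltW ?hM.
have yr : abs y <= r.
  rewrite -[y](subKr (u 0%N)) absB_le //; exact: le_trans (uyr 0%N) Pr_le.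
exists y; split=> //; first exact: (uyr 0%N).
apply/(abs_cvgP nE) => eps e0; have [M1 h1] := e_to0 _ e0; have [M2 h2] := uy _ e0.
exists (N + maxn M1 M2)%N => M NM; have Nle : (N <= M)%N by lia.
rewrite subr0 -(subnKC Nle); set m := (M - N)%N.
have [m1 m2] : (M1 <= m)%N /\ (M2 <= m)%N by rewrite /m; lia.
(* The partial sum at y differs from the one at [u m] by |u m - y|, by the isometry property. *)
set l := log_partial a _ y; rewrite -(subKr (log_partial a (N + m) (u m)) l).
apply: absB_lt => //; first exact: h1.
rewrite /l log_partial_isometry ?addn_gt0 ?N0 ?h2 //; by case: (inv m).
Qed.

(** Provides the starting condition for a Newton iteration from a zero of l towards one of l_N: a
    late partial sum and the terms in between are all at most P r. *)
Lemma log_zero_partial_le N (x : E) :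
  (forall k, (N <= k)%N -> P ^- k * r ^+ (p ^ k) <= P * r) -> abs x <= r ->
  abs_cvg abs (fun M => log_partial a M x) 0 -> abs (log_partial a N x) <= P * r.
Proof.
move=> tail xr /(abs_cvgP nE)/(_ _ Pr_gt0)[M hM].
have {hM} := hM _ (leq_addl N M); rewrite subr0 => /ltW hM.
rewrite -(subKr (log_partial a (N + M) x) (log_partial a N x)) absB_le //.
rewrite /log_partial big_split_ord /= addrAC subrr add0r.
apply: abs_sum_le => // [|k _]; first exact: ltW.
by apply: le_trans (abs_log_term _ xr) _; rewrite tail ?leq_addr.
Qed.

End Coefficients.

(** Makes l_N itself a series of the same kind, so that the passage between zeros of l and of l_N
    becomes symmetric. *)
Lemma log_partial_trunc (a : nat -> E) N M (x : E) : (N <= M)%N ->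
  log_partial (fun k => if (k < N)%N then a k else 0) M x = log_partial a N x.
Proof.
move=> NM; rewrite /log_partial -(subnKC NM) big_split_ord /= [X in _ + X]big1 => [|k _].
  by rewrite addr0; apply: eq_bigr => k _; rewrite ltn_ord.
by rewrite ltnNge leq_addr /= !mul0r.
Qed.

Lemma log_zero_correspondence (a : nat -> E) N : (0 < N)%N ->
  (forall k, abs (a k) <= 1) -> abs (a 0%N) = 1 ->
  (forall k, (N <= k)%N -> P ^- k * r ^+ (p ^ k) <= P * r) ->
  exists2 phi : E -> E,
    set_bij [set x | abs x <= r /\ log_partial a N x = 0]
            [set x | abs x <= r /\ abs_cvg abs (fun M => log_partial a M x) 0] phi
    & forall x, abs x <= r -> log_partial a N x = 0 -> abs (phi x) = abs x.
Proof.
move=> N0 a_le1 a0 tail.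
pose b k := if (k < N)%N then a k else 0.
have b_le1 k : abs (b k) <= 1 by rewrite /b; case: ifP => // _; rewrite abs0.
have b0 : abs (b 0%N) = 1 by rewrite /b N0.
have zb x : abs_cvg abs (fun M => log_partial b M x) 0 <-> log_partial a N x = 0.
  split=> [/(abs_cvgP nE) h|h].
    apply: (abs_cvg0_cst nE); apply/(abs_cvgP nE) => eps e0; have [M hM] := h _ e0.
    exists 0%N => _ _; have := hM (N + M)%N (leq_addl _ _).
    by rewrite log_partial_trunc ?leq_addr.
  apply/(abs_cvgP nE) => eps e0; exists N => M NM.
  by rewrite log_partial_trunc // h subr0 abs0.
have /choice[phi hphi] x : exists y, abs x <= r -> log_partial a N x = 0 ->
    [/\ abs y <= r, abs (x - y) <= P * r & abs_cvg abs (fun M => log_partial a M y) 0].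
  have [[xr lx]|h] := pselect (abs x <= r /\ log_partial a N x = 0).
    have [|y hy] := log_newton a_le1 a0 N0 tail xr; last by exists y.
    by rewrite lx abs0 // ltW.
  by exists 0 => xr lx; case: h.
have zero_a : abs_cvg abs (fun M => log_partial a M 0) 0.
  apply/(abs_cvgP nE) => eps e0; exists 0%N => M _.
  rewrite /log_partial big1 ?subr0 ?abs0 // => k _.
  by rewrite expr0n expn_eq0 gtn_eqF ?mulr0 // ltnW.
have zero_b : log_partial a N 0 = 0.
  rewrite /log_partial big1 // => k _.
  by rewrite expr0n expn_eq0 gtn_eqF ?mulr0 // ltnW.
exists phi; first split.
- by move=> x [xr lx]; case: (hphi x xr lx).
- move=> x y /set_mem[xr lx] /set_mem[yr ly] xy.
  have [_ hx _] := hphi x xr lx; have [_ hy _] := hphi y yr ly.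
  apply: (log_zero_unique b_le1 b0 xr yr); try exact/zb.
  have -> : x - y = (x - phi x) - (y - phi y) by rewrite xy; ring.
  exact: absB_le.
- move=> y [yr ly].
  (* Surjectivity: the iteration for the truncated series, started at the zero y of l, gives a zero
     x of l_N. Both y and [phi x] are zeros of l close to x, so they agree. *)
  have [|x [xr xy /zb lx]] := log_newton b_le1 b0 N0 tail yr.
    by rewrite log_partial_trunc // log_zero_partial_le.
  exists x => //; have [fr fx lf] := hphi x xr lx.
  apply: (log_zero_unique a_le1 a0) => //.
  have -> : phi x - y = - (x - phi x) - (y - x) by ring.
  by rewrite absB_le ?absN.
move=> x xr lx; have [fr fx lf] := hphi x xr lx.
(* If |x| > P r, closeness preserves the absolute value. Otherwise x lies in the ball of the zero 0,
   and uniqueness makes x and [phi x] both 0. *)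
have [xP|xP] := ltP (P * r) (abs x).
  by apply: (abs_close nE); apply: le_lt_trans xP.
have abs0r : abs 0 <= r by rewrite abs0 // ltW.
have x0 : x = 0.
  apply: (log_zero_unique b_le1 b0 xr abs0r); try exact/zb.
  by rewrite subr0.
congr abs; apply: (log_zero_unique a_le1 a0 fr xr) => //; last by rewrite x0.
by rewrite absBC.
Qed.

End Newton.

(** * Newton polygons *)

Section RootCount.
Variables (R : realType) (E : fieldType) (abs : E -> R).
Hypothesis nE : nonarch_absval abs.
Variable r : R.
Hypothesis r0 : 0 < r.
Implicit Types (f : {poly E}) (z c : E) (s : seq E) (m i : nat).

Let rX0 i : 0 < r ^+ i. Proof. by rewrite exprn_gt0. Qed.

(* m is the right end of the segment of the Newton polygon of f attached to
   the radius r. *)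
Definition last_dominant f m : Prop :=
  [/\ f`_m != 0, forall i, abs f`_i * r ^+ i <= abs f`_m * r ^+ m
    & forall i, (m < i)%N -> abs f`_i * r ^+ i < abs f`_m * r ^+ m].

Lemma last_dominant_unique f m m' : last_dominant f m -> last_dominant f m' -> m = m'.
Proof.
move=> [_ h1 h2] [_ h1' h2']; case: (ltngtP m m') => // [/h2|/h2'].
  by rewrite ltNge h1'.
by rewrite ltNge h1.
Qed.

(** The coefficients of the product are f_(i-1) - z f_i. For |z| <= r the part X f decides and moves
    the last maximum one place to the right; for |z| > r the part z f decides and leaves it in
    place. *)
Lemma last_dominant_mul f z m : last_dominant f m ->
  last_dominant (('X - z%:P) * f) (m + (abs z <= r)%R).
Proof.
move=> [fm0 h1 h2]; set W := abs f`_m * r ^+ m in h1 h2.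
have W0 : 0 < W by rewrite mulr_gt0 ?(abs_gt0 nE).
pose lo i := if i == 0%N then 0 else f`_i.-1.
have gE i : (('X - z%:P) * f)`_i = lo i - z * f`_i.
  by rewrite mulrBl coefB coefXM coefCM.
have lo_le i : abs (lo i) * r ^+ i <= r * W.
  rewrite /lo; case: i => [|i] /=; first by rewrite (abs0 nE) mul0r mulr_ge0 ?ltW.
  by rewrite exprS mulrCA ler_pM2l.
have hi_le i : abs (z * f`_i) * r ^+ i <= abs z * W.
  by rewrite (absM nE) -mulrA ler_wpM2l ?(abs_ge0 nE).
have subr_le i B : abs (lo i) * r ^+ i <= B -> abs (z * f`_i) * r ^+ i <= B ->
    abs (lo i - z * f`_i) * r ^+ i <= B.
  rewrite -!(ler_pdivlMr _ _ (rX0 i)); exact: (absB_le nE).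
have subr_lt i B : abs (lo i) * r ^+ i < B -> abs (z * f`_i) * r ^+ i < B ->
    abs (lo i - z * f`_i) * r ^+ i < B.
  rewrite -!(ltr_pdivlMr _ _ (rX0 i)); exact: (absB_lt nE).
have [zr|rz] := leP (abs z) r.
  have zf_le : abs z * W <= r * W by rewrite ler_pM2r.
  (* Even for |z| = r there is no cancellation at m + 1, because m is the last maximal index of
     f. *)
  have top : abs (lo m.+1 - z * f`_m.+1) = abs f`_m.
    rewrite (abs_dominant nE) // (absN nE) -(ltr_pM2r (rX0 m.+1)) (absM nE) -mulrA /lo /=.
    rewrite exprS [ltRHS]mulrCA -exprS.
    apply: le_lt_trans (ler_wpM2r _ zr) _; first by rewrite mulr_ge0 ?(abs_ge0 nE) ?ltW.
    by rewrite ltr_pM2l // h2.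
  have topW : abs f`_m * r ^+ m.+1 = r * W by rewrite exprS mulrCA.
  rewrite addn1; split=> [|i|i mi]; rewrite ?gE.
  - by rewrite -(abs_gt0 nE) top (abs_gt0 nE).
  - by rewrite top topW subr_le // (le_trans (hi_le i)).
  - rewrite top topW subr_lt //.
      rewrite /lo; case: i mi => // i mi /=.
      by rewrite exprS mulrCA ltr_pM2l // h2.
    rewrite (absM nE) -mulrA; apply: le_lt_trans (ler_wpM2r _ zr) _.
      by rewrite mulr_ge0 ?(abs_ge0 nE) ?ltW.
    by rewrite ltr_pM2l // h2 // ltnW.
have z0 : 0 < abs z by apply: lt_trans rz.
have rW : r * W < abs z * W by rewrite ltr_pM2r.
have topW : abs (lo m - z * f`_m) * r ^+ m = abs z * W.
  rewrite -opprB (absN nE) (abs_dominant nE) ?(absN nE) ?(absM nE) -?mulrA //.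
  by rewrite -(ltr_pM2r (rX0 m)) -mulrA; apply: le_lt_trans rW.
rewrite addn0; split=> [|i|i mi]; rewrite ?gE.
- rewrite -(abs_gt0 nE) -(pmulr_lgt0 _ (rX0 m)) topW mulr_gt0 //.
- by rewrite topW subr_le // ltW // (le_lt_trans (lo_le i)).
- rewrite topW subr_lt //; first by rewrite (le_lt_trans (lo_le i)).
  by rewrite (absM nE) -mulrA ltr_pM2l // h2.
Qed.

Lemma last_dominant_count c s : c != 0 ->
  last_dominant (c *: \prod_(z <- s) ('X - z%:P)) (count (fun z => abs z <= r) s).
Proof.
move=> c0; elim: s => [|z s IHs].
  rewrite big_nil /= alg_polyC; split=> [|i|i i0]; rewrite !coefC eqxx //.
    case: eqP => [->|_] //; by rewrite (abs0 nE) mul0r mulr_ge0 ?(abs_ge0 nE) ?ltW.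
  by rewrite gtn_eqF // (abs0 nE) mul0r mulr_gt0 ?(abs_gt0 nE).
rewrite big_cons -mul_polyC mulrCA mul_polyC /= addnC.
exact: last_dominant_mul.
Qed.

End RootCount.

(** * The radii r_s and the sizes of the terms of l *)

Section TorsionRadii.
Variables (R : realType) (p : nat) (P : R).
Hypotheses (p1 : (1 < p)%N) (P01 : 0 < P < 1).
Let P0 : 0 < P. Proof. by case/andP: P01. Qed.
Let P1 : P < 1. Proof. by case/andP: P01. Qed.

Local Notation dif s := (p ^ s - p ^ s.-1)%N.

(** For s > 0, the radius at which the terms of index s - 1 and s of l have equal size. For s = 0
    the exponent is the inverse of 0, hence 0, and the value is 1. *)
Definition log_radius (s : nat) : R := P `^ ((dif s)%:R)^-1.

Definition term_bound (rho : R) (k : nat) : R := P ^- k * rho ^+ (p ^ k).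

Lemma dif_gt0 s : (0 < s)%N -> (0 < dif s)%N.
Proof. by case: s => // s _; rewrite subn_gt0 /= ltn_exp2l. Qed.

Lemma difS s : dif s.+1 = (p ^ s * p.-1)%N.
Proof. by rewrite expnSr /= -{2}[(p ^ s)%N]muln1 -mulnBr subn1. Qed.

Lemma dif_lt s s' : (0 < s)%N -> (s < s')%N -> (dif s < dif s')%N.
Proof.
case: s => // s; case: s' => // s' _ ss'; rewrite !difS ltn_mul2r ltn_exp2l //.
by apply/andP; split; lia.
Qed.

Lemma log_radius_gt0 s : 0 < log_radius s. Proof. exact: powR_gt0. Qed.

Lemma log_radiusX s : (0 < s)%N -> log_radius s ^+ dif s = P.
Proof.
move=> s0; rewrite -powR_mulrn ?ltW ?log_radius_gt0 // /log_radius -powRrM mulVf ?powRr1 ?ltW //.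
by rewrite pnatr_eq0 -lt0n dif_gt0.
Qed.

Lemma log_radius_lt1 s : (0 < s)%N -> log_radius s < 1.
Proof.
move=> s0; rewrite ltNge; apply/negP => h.
by have := exprn_ege1 (dif s) h; rewrite log_radiusX // leNgt P1.
Qed.

Lemma lt_log_radiusX s rho : (0 < s)%N -> 0 <= rho -> (rho < log_radius s) = (rho ^+ dif s < P).
Proof.
move=> s0 rho0; rewrite -[X in _ = (_ < X)](log_radiusX s0) ltr_pXn2r ?dif_gt0 ?nnegrE //.
exact/ltW/log_radius_gt0.
Qed.

Lemma gt_log_radiusX s rho : (0 < s)%N -> 0 <= rho -> (log_radius s < rho) = (P < rho ^+ dif s).
Proof.
move=> s0 rho0; rewrite -[X in _ = (X < _)](log_radiusX s0) ltr_pXn2r ?dif_gt0 ?nnegrE //.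
exact/ltW/log_radius_gt0.
Qed.

Lemma log_radius_lt s s' : (0 < s)%N -> (s < s')%N -> log_radius s < log_radius s'.
Proof.
move=> s0 ss'; rewrite lt_log_radiusX ?(leq_trans _ ss') ?ltW ?log_radius_gt0 //.
by rewrite -[ltRHS](log_radiusX s0) ltr_iXn2l ?log_radius_gt0 ?log_radius_lt1 ?dif_lt.
Qed.

Lemma log_radius_le s s' : (0 < s)%N -> (s <= s')%N -> log_radius s <= log_radius s'.
Proof.
move=> s0; rewrite leq_eqVlt => /predU1P[-> //|ss'].
by rewrite ltW ?log_radius_lt.
Qed.

Section TermBound.
Variable rho : R.
Hypotheses (rho0 : 0 < rho) (rho1 : rho < 1).

Lemma term_bound_gt0 k : 0 < term_bound rho k.
Proof. by rewrite mulr_gt0 ?invr_gt0 ?exprn_gt0. Qed.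

(** The ratio is below 1 exactly for rho < r_(k+1). As these radii increase with k, the sizes of the
    terms first rise and then fall. *)
Lemma term_boundS k : term_bound rho k.+1 = term_bound rho k * (P^-1 * rho ^+ dif k.+1).
Proof.
rewrite /term_bound [P ^+ k.+1]exprSr invfM mulrACA -exprD subnKC //.
by rewrite /= leq_exp2l.
Qed.

Lemma term_bound_decr m k : rho < log_radius m.+1 -> (m < k)%N ->
  term_bound rho k < term_bound rho m.
Proof.
rewrite lt_log_radiusX ?ltW // => hm mk.
have step j : (m <= j)%N -> term_bound rho j.+1 < term_bound rho j.
  move=> mj; rewrite term_boundS gtr_pMr ?term_bound_gt0 //.
  rewrite ltr_pdivrMl // mulr1; apply: le_lt_trans hm.
  rewrite ler_wiXn2l ?ltW //; move: mj; rewrite leq_eqVlt => /predU1P[-> //|mj].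
  exact/ltnW/dif_lt.
rewrite -(subnKC mk); elim: (k - m.+1)%N => [|j IHj]; first by rewrite addn0 step.
by rewrite addnS; apply: lt_trans IHj; apply: step; lia.
Qed.

Lemma term_bound_incr m k : log_radius m <= rho -> (k <= m)%N ->
  term_bound rho k <= term_bound rho m.
Proof.
move=> hm km; have step j : (j < m)%N -> term_bound rho j <= term_bound rho j.+1.
  move=> jm; rewrite term_boundS ler_pMr ?term_bound_gt0 // ler_pdivlMl // mulr1.
  rewrite leNgt -lt_log_radiusX ?ltW // -leNgt; apply: le_trans hm.
  exact: log_radius_le.
have ind i : (k + i <= m)%N -> term_bound rho k <= term_bound rho (k + i).
  elim: i => [|i IHi]; rewrite ?addn0 // addnS => kim.
  by apply: le_trans (IHi (ltnW kim)) (step _ kim).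
by have := ind (m - k)%N; rewrite subnKC // leqnn; apply.
Qed.

Lemma term_bound_incr_lt m k : log_radius m < rho -> (k < m)%N ->
  term_bound rho k < term_bound rho m.
Proof.
case: m => // m hm km; apply: le_lt_trans (_ : _ <= term_bound rho m) _.
  have [m0|m0] := posnP m; first by have -> : k = m by lia.
  by apply: term_bound_incr => //; apply: le_trans (ltW hm); rewrite log_radius_le.
rewrite term_boundS ltr_pMr ?term_bound_gt0 // ltr_pdivlMl // mulr1.
by rewrite -gt_log_radiusX ?ltW.
Qed.

End TermBound.
End TorsionRadii.

(** * Roots of the truncations l_N *)

Section LogRoots.
Variables (R : realType) (E : fieldType) (abs : E -> R).
Hypothesis nE : nonarch_absval abs.
Variable p : nat.
Local Notation P := (abs p%:R).
Local Notation log_radius := (log_radius p P).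
Local Notation term_bound := (term_bound p P).
Hypotheses (p1 : (1 < p)%N) (P01 : 0 < P < 1).
Variable a : nat -> E.
Hypothesis a1 : forall k, abs (a k) = 1.
Local Notation log_partial := (log_partial p a).

Let P0 : 0 < P. Proof. by case/andP: P01. Qed.
Let p_neq0 : p%:R != 0 :> E. Proof. by rewrite -(abs_gt0 nE). Qed.

Lemma abs_log_coef k : abs (a k / p%:R ^+ k) = P ^- k.
Proof. by rewrite (absM nE) (absV nE) (absX nE) a1 mul1r. Qed.

(** Strictly between consecutive radii one term is larger than all others. The case m = 0 is
    separate because [log_radius 0] is 1 and not a lower bound. *)
Lemma abs_log_partial_gap (x : E) m M : 0 < abs x < 1 ->
  (m = 0%N \/ log_radius m < abs x) -> abs x < log_radius m.+1 -> (m < M)%N ->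
  abs (log_partial M x) = term_bound (abs x) m.
Proof.
move=> /andP[x0 x1] hm hm1 mM.
have absT k : abs (a k / p%:R ^+ k * x ^+ (p ^ k)) = term_bound (abs x) k.
  by rewrite (absM nE) abs_log_coef (absX nE).
rewrite /log_partial (bigD1 (Ordinal mM)) //= (abs_dominant nE) absT //.
apply: (abs_sum_lt nE) => [|k km]; first exact: term_bound_gt0.
rewrite absT; have {}km : k != m :> nat by exact: km.
case: (ltngtP k m) km => // [km|mk] _; last exact: term_bound_decr.
by case: hm => [m0|hm]; [rewrite m0 in km | exact: term_bound_incr_lt].
Qed.

(** With s least such that |x| <= r_s, a strict inequality would place x in a gap. Excluding gaps is
    left as a hypothesis so that the lemma serves roots of l_N as well as zeros of l. *)
Lemma abs_log_zero (x : E) n : (0 < n)%N -> x != 0 -> abs x <= log_radius n ->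
  (forall m, (m < n)%N -> (forall M, (m < M)%N -> abs (log_partial M x) = term_bound (abs x) m) ->
     False) ->
  exists2 s, (1 <= s <= n)%N & abs x = log_radius s.
Proof.
move=> n0 x0 xn nogap; have x_gt0 : 0 < abs x by rewrite (abs_gt0 nE).
have ex : exists s, (0 < s)%N && (abs x <= log_radius s) by exists n; rewrite n0.
case: (ex_minnP ex) => -[//|m] /andP[_ xm] smin.
have mn : (m < n)%N by apply: smin; rewrite n0.
exists m.+1 => //; apply/le_anti; rewrite xm /= leNgt; apply/negP => xlt.
apply: (nogap m mn) => M mM; apply: abs_log_partial_gap => //.
  by rewrite x_gt0 (le_lt_trans xm) // log_radius_lt1.
have [->|m0] := posnP m; [by left|right; rewrite ltNge; apply/negP => h].
by have := smin m; rewrite m0 h ltnn => /(_ isT).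
Qed.

Definition log_poly N : {poly E} := \sum_(k < N) (a k / p%:R ^+ k) *: 'X^(p ^ k).

Lemma horner_log_poly N x : (log_poly N).[x] = log_partial N x.
Proof. by rewrite /log_poly horner_sum; apply: eq_bigr => k _; rewrite hornerZ hornerXn. Qed.

Lemma coef_log_poly N k : (k < N)%N -> (log_poly N)`_(p ^ k) = a k / p%:R ^+ k.
Proof.
move=> kN; rewrite coef_sum (bigD1 (Ordinal kN)) //= coefZ coefXn eqxx mulr1.
rewrite big1 ?addr0 // => j jk; rewrite coefZ coefXn eqn_exp2l // eq_sym.
by rewrite (negPf (_ : j != k :> nat)) ?mulr0.
Qed.

Lemma coef_log_polyP N i :
  (log_poly N)`_i = 0 \/ exists2 k, (k < N)%N & i = (p ^ k)%N.
Proof.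
have [[k kN ->]|h] := pselect (exists2 k, (k < N)%N & i = (p ^ k)%N).
  by right; exists k.
left; rewrite coef_sum big1 // => k _; rewrite coefZ coefXn; case: eqP => [ik|_].
  by case: h; exists k.
by rewrite mulr0.
Qed.

(** At the radius r_s the terms grow weakly up to index s and are strictly smaller afterwards. *)
Lemma log_poly_last_dominant N s : (0 < s)%N -> (s < N)%N ->
  last_dominant abs (log_radius s) (log_poly N) (p ^ s).
Proof.
move=> s0 sN; have [r0 r1] := (log_radius_gt0 p P01 s, log_radius_lt1 p1 P01 s0).
have absT k : (k < N)%N ->
    abs (log_poly N)`_(p ^ k) * log_radius s ^+ (p ^ k) = term_bound (log_radius s) k.
  by move=> kN; rewrite coef_log_poly // abs_log_coef.
rewrite /last_dominant absT //; split=> [|i|i].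
- by rewrite coef_log_poly // -(abs_gt0 nE) abs_log_coef invr_gt0 exprn_gt0.
- case: (coef_log_polyP N i) => [->|[k kN ->]].
    by rewrite (abs0 nE) mul0r ltW // term_bound_gt0.
  rewrite absT //; have [ks|sk] := leqP k s; first exact: term_bound_incr.
  by rewrite ltW // term_bound_decr // log_radius_lt.
case: (coef_log_polyP N i) => [-> _|[k kN ->]].
  by rewrite (abs0 nE) mul0r term_bound_gt0.
by rewrite ltn_exp2l // absT // => sk; rewrite term_bound_decr // log_radius_lt.
Qed.

(** Differentiation cancels the denominators: the terms become a_k x^(p^k - 1), and a_0 dominates in
    the open unit disc. *)
Lemma deriv_log_poly N x : (0 < N)%N -> abs x < 1 -> (log_poly N)^`().[x] != 0.
Proof.
case: N => // N _ x1; rewrite /log_poly raddf_sum /= horner_sum big_ord_recl /=.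
have dE (k : nat) : ((a k / p%:R ^+ k) *: 'X^(p ^ k))^`().[x] = a k * x ^+ (p ^ k).-1.
  rewrite derivZ derivXn hornerZ hornerMn hornerXn -[_ *+ (p ^ k)]mulr_natl natrX.
  by rewrite mulrA mulfVK ?expf_neq0.
rewrite dE mulr1 -(abs_gt0 nE) (abs_dominant nE) ?a1 //.
apply: (abs_sum_lt nE) => // k _; rewrite dE (absM nE) a1 mul1r (absX nE).
rewrite exprn_ilt1 ?(abs_ge0 nE) // /bump /=.
have : (1 < p ^ (1 + k))%N by rewrite -(expn0 p) ltn_exp2l.
by case: (p ^ _)%N => [|[]].
Qed.

Section Roots.
Variables (N : nat) (c : E) (s : seq E).
Hypotheses (N0 : (0 < N)%N) (c0 : c != 0).
Hypothesis factor : log_poly N = c *: \prod_(z <- s) ('X - z%:P).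

Lemma mem_log_roots z : (z \in s) = (log_partial N z == 0).
Proof.
by rewrite -root_prod_XsubC -horner_log_poly factor hornerZ mulf_eq0 (negPf c0).
Qed.

Lemma log_roots_simple z : abs z < 1 -> (count_mem z s <= 1)%N.
Proof.
move=> z1; rewrite leqNgt; apply/negP => h.
have zs : z \in s by rewrite -has_pred1 has_count ltnW.
have zs' : z \in rem z s.
  rewrite -has_pred1 has_count; move: h.
  by rewrite (permP (perm_to_rem zs)) /= eqxx.
have := deriv_log_poly N0 z1; rewrite factor (perm_big _ (perm_to_rem zs)) /=.
rewrite big_cons (perm_big _ (perm_to_rem zs')) /= big_cons derivZ !derivM derivXsubC.
by rewrite !hornerE subrr !(mul0r, mulr0, addr0) eqxx.
Qed.

Lemma log_roots_uniq (Q : pred E) : (forall z, Q z -> abs z < 1) -> uniq [seq z <- s | Q z].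
Proof.
move=> Q1; apply: count_mem_uniq => z.
case: (boolP (z \in [seq z <- s | Q z])) => [|/count_memPn ->//].
move=> zQ; apply/eqP; rewrite eqn_leq -has_count has_pred1 zQ andbT.
move: zQ; rewrite mem_filter => /andP[/Q1/log_roots_simple z1 _]; apply: leq_trans z1.
by rewrite count_filter; apply: sub_count => x /andP[].
Qed.

(** The last dominant index is computed twice, from the factorization and from the coefficients. *)
Lemma count_log_roots_le m : (0 < m)%N -> (m < N)%N ->
  count (fun z => abs z <= log_radius m) s = (p ^ m)%N.
Proof.
move=> m0 mN; have r0 := log_radius_gt0 p P01 m.
apply: (last_dominant_unique (abs := abs) (r := log_radius m) (f := log_poly N)).
  by rewrite factor; apply: last_dominant_count.
exact: log_poly_last_dominant.
Qed.

Lemma abs_log_root z m : (0 < m)%N -> (m <= N)%N -> z \in s -> z != 0 ->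
  abs z <= log_radius m -> exists2 k, (1 <= k <= m)%N & abs z = log_radius k.
Proof.
move=> m0 mN; rewrite mem_log_roots => /eqP lz z0 zm.
apply: abs_log_zero => // j jm /(_ N (leq_trans jm mN)); rewrite lz (abs0 nE) => h.
have z_gt0 : 0 < abs z by rewrite (abs_gt0 nE).
by have := term_bound_gt0 p P01 z_gt0 j; rewrite -h ltxx.
Qed.

Lemma zero_log_root : 0 \in s.
Proof.
rewrite mem_log_roots /log_partial big1 // => k _.
by rewrite expr0n expn_eq0 gtn_eqF ?mulr0 // ltnW.
Qed.

(** No root has absolute value strictly between r_(m-1) and r_m, so the closed disc of radius
    r_(m-1) is counted. For m = 1 only the simple root 0 remains. *)
Lemma count_log_roots_lt m : (0 < m)%N -> (m < N)%N ->
  count (fun z => abs z < log_radius m) s = (p ^ m.-1)%N.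
Proof.
case: m => // -[_ _|m _ mN] /=.
  have := log_roots_simple (z := 0); rewrite (abs0 nE) => /(_ ltr01) le1.
  rewrite -[RHS](_ : count_mem 0 s = 1%N); last first.
    by apply/eqP; rewrite eqn_leq le1 -has_count has_pred1 zero_log_root.
  apply: eq_in_count => z zs /=; apply/idP/eqP => [z1|->]; last first.
    by rewrite (abs0 nE) log_radius_gt0.
  apply/eqP/negPn/negP => z0; have [k] := abs_log_root (ltnSn 0) N0 zs z0 (ltW z1).
  by rewrite -eqn_leq => /eqP <- h; rewrite h ltxx in z1.
rewrite -(count_log_roots_le (m := m.+1)) ?(ltnW mN) //.
apply: eq_in_count => z zs; apply/idP/idP => [zm|/le_lt_trans]; last first.
  by apply; apply: log_radius_lt.
have [->|z0] := eqVneq z 0; first by rewrite (abs0 nE) ltW ?log_radius_gt0.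
have [k /andP[k0 km] zk] := abs_log_root (ltn0Sn m.+1) (ltnW mN) zs z0 (ltW zm).
rewrite zk log_radius_le //; move: km; rewrite leq_eqVlt => /predU1P[kE|//].
by rewrite zk kE ltxx in zm.
Qed.

Lemma count_log_roots_eq m : (0 < m)%N -> (m < N)%N ->
  count (fun z => abs z == log_radius m) s = (p ^ m - p ^ m.-1)%N.
Proof.
move=> m0 mN; rewrite -(count_log_roots_le m0 mN) -(count_log_roots_lt m0 mN).
rewrite -[LHS](addnK (count (fun z => abs z < log_radius m) s)); congr (_ - _)%N.
elim: (s) => //= z t IHt; rewrite addnACA IHt le_eqVlt.
by case: eqP => [->|_]; rewrite ?ltxx.
Qed.

End Roots.
End LogRoots.

(** * Torsion points *)

Lemma card_uniq_seq (T : choiceType) (x0 : T) (l : seq T) : uniq l -> [set` l] #= `I_(size l).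
Proof.
move=> ul; have <- : nth x0 l @` `I_(size l) = [set` l].
  apply/seteqP; split=> [_ [k /= kl <-]|x /= xl]; first exact: mem_nth.
  by exists (index x l); rewrite /= ?index_mem ?nth_index.
apply: inj_card_eq => j k /set_mem jl /set_mem kl /eqP.
by rewrite nth_uniq // => /eqP.
Qed.

Section TorsionCount.
Variables (R : realType) (p : nat) (K : fieldType) (absK : K -> R).
Hypotheses (nK : nonarch_absval absK) (cK : abs_complete absK).
Hypotheses (p1 : (1 < p)%N) (P01 : 0 < absK p%:R < 1).
Variable a : nat -> K.
Hypothesis a1 : forall k, absK (a k) = 1.

Lemma torsion_count n : (0 < n)%N ->
  exists (K' : fieldExtType K) (absK' : K' -> R),
    let T := torsion_set p absK' a n in
    [/\ absval_extends absK absK',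
        T #= `I_(p ^ n),
        forall x, T x -> x != 0 ->
          exists2 s : nat, (1 <= s <= n)%N & absK' x = torsion_radius p absK' s
      & forall s : nat, (1 <= s <= n)%N ->
          T `&` [set x | absK' x = torsion_radius p absK' s] #= `I_(p ^ s - p ^ s.-1)].
Proof.
move=> n0; pose P := absK p%:R; pose r := log_radius p P n.
have [P0 P1] := andP P01.
have r0 : 0 < r by exact: log_radius_gt0.
have r01 : 0 < r < 1 by rewrite r0 log_radius_lt1.
(* N > n makes p^n a vertex of the polygon of l_N; [tail] bounds the omitted terms for the
   correspondence of zeros. *)
have [N nN tail] : exists2 N, (n < N)%N &
    forall k, (N <= k)%N -> P ^- k * r ^+ (p ^ k) <= P * r.
  have [N hN] := term_bound_small p1 P01 r01 (mulr_gt0 P0 r0).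
  exists (maxn N n.+1); first exact: leq_maxr.
  by move=> k; rewrite geq_max => /andP[/hN/ltW].
have N0 : (0 < N)%N by apply: leq_trans nN.
have q0 : log_poly p a N != 0.
  have := log_poly_last_dominant nK p1 P01 a1 n0 nN => -[+ _ _].
  by apply: contra_neq => ->; rewrite coef0.
have [K' [s Ds]] := splitting_extension q0.
have [abs extK] := @absval_extension_exists R K K' absK nK.
exists K', abs => T; have nE : nonarch_absval abs := extK.1.
have absP : abs p%:R = P by rewrite /P -extK.2 scaler_nat.
pose b k : K' := (a k)%:A; have b1 k : abs (b k) = 1 by rewrite extK.2.
have cE : abs_complete abs := complete_extension extK cK.
have P01' : 0 < abs p%:R < 1 by rewrite absP.
have radE k : torsion_radius p abs k = log_radius p (abs p%:R) k by [].
pose c := lead_coef (log_poly p b N).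
have mapE : map_poly (in_alg K') (log_poly p a N) = log_poly p b N.
  rewrite /log_poly rmorph_sum; apply: eq_bigr => k _ /=.
  by rewrite map_polyZ map_polyXn rmorphM fmorphV rmorphXn rmorph_nat.
have c0 : c != 0 by rewrite lead_coef_eq0 -mapE map_poly_eq0.
have factor : log_poly p b N = c *: \prod_(z <- s) ('X - z%:P).
  have := eqp_eq Ds; rewrite mapE (monicP (monic_prod_XsubC _ _ _)) scale1r.
  exact.
have r01' : 0 < log_radius p (abs p%:R) n < 1 by rewrite absP.
have tail' k : (N <= k)%N ->
    abs p%:R ^- k * log_radius p (abs p%:R) n ^+ (p ^ k) <= abs p%:R * log_radius p (abs p%:R) n.
  by rewrite absP; apply: tail.
have b_le1 k : abs (b k) <= 1 by rewrite b1.
have [phi [phiT phi_inj phi_surj] phi_abs] :=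
  log_zero_correspondence nE cE p1 P01' r01' N0 b_le1 (b1 0%N) tail'.
set S := [set x | _ /\ _] in phiT phi_inj phi_surj.
have TE : T = [set x | abs x <= log_radius p (abs p%:R) n /\
                 abs_cvg abs (fun M => log_partial p b M x) 0].
  apply/seteqP; split=> x /=; first by case.
  move=> [xr lx]; split=> //; apply: le_lt_trans xr _; by case/andP: r01'.
have imS : T = phi @` S.
  rewrite TE; apply/seteqP; split; [exact: phi_surj | by move=> _ [x Sx <-]; exact: phiT].
have SE x : S x <-> (x \in s) /\ abs x <= log_radius p (abs p%:R) n.
  rewrite /S /= (mem_log_roots c0 factor).
  by split=> [[? ->]|[/eqP]].
(* Both counts reduce to this: phi is injective and the roots in the disc are distinct, so counting
   in the list s gives the cardinality. *)
have card_im (Q : pred K') (B : set K') : (forall x, B x <-> x \in s /\ Q x) ->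
    (forall x, Q x -> abs x <= log_radius p (abs p%:R) n) -> phi @` B #= `I_(count Q s).
  move=> BE Qr; have BS : B `<=` S by move=> x /BE[xs /Qr xr]; apply/SE.
  apply: card_eq_trans (_ : _ #= B) _.
    by apply: inj_card_eq => x y /set_mem/BS xS /set_mem/BS yS; apply: phi_inj; apply/mem_set.
  have -> : B = [set` [seq z <- s | Q z]].
    apply/seteqP; split=> x /=; rewrite mem_filter.
      by move=> /BE[-> ->].
    by move=> /andP[Qx xs]; apply/BE.
  rewrite -size_filter; apply: (card_uniq_seq 0).
  apply: (log_roots_uniq nE p1 P01' b1 N0 factor) => z /Qr zr.
  by apply: le_lt_trans zr _; case/andP: r01'.
split=> //.
- rewrite imS -(count_log_roots_le nE p1 P01' b1 c0 factor n0 nN).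
  exact: card_im.
- move=> x; rewrite TE => -[xr /(abs_cvgP nE) lx] x0.
  (* In a gap the partial sums would keep a constant positive absolute value, and could not tend to
     0. *)
  apply: (abs_log_zero nE p1 P01' b1 n0 x0 xr) => m mn h.
  have x_gt0 : 0 < abs x by rewrite (abs_gt0 nE).
  have [M hM] := lx _ (term_bound_gt0 p P01' x_gt0 m).
  have := hM (maxn M m.+1) (leq_maxl _ _).
  by rewrite subr0 h ?leq_maxr // ltxx.
move=> m /andP[m0 mn].
(* Since phi preserves absolute values, it maps the roots of l_N on each circle onto the torsion
   points there. *)
have -> : T `&` [set x | abs x = torsion_radius p abs m] =
    phi @` (S `&` [set x | abs x = torsion_radius p abs m]).
  rewrite imS; apply/seteqP; split=> [_ [[x Sx <-] /= hx]|_ [x [Sx /= hx] <-]].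
    by exists x => //; split=> //=; case: Sx => xr lx; rewrite -phi_abs.
  by split; [exists x | case: Sx => xr lx /=; rewrite phi_abs].
rewrite -(count_log_roots_eq nE p1 P01' b1 N0 c0 factor m0 (leq_ltn_trans mn nN)).
apply: card_im => x.
  split=> [[/SE[xs xr] /= ->]|[xs /eqP xm]]; first by rewrite radE eqxx.
  by split=> //; apply/SE; rewrite xm log_radius_le.
by move=> /eqP ->; rewrite log_radius_le.
Qed.

End TorsionCount.

Lemma integer_unit_abs (R : realType) (F : fieldType) (abs : F -> R) (x : F) :
  nonarch_absval abs -> integer_unit abs x -> abs x = 1.
Proof.
move=> nF [x1 [y y1 xy]]; apply/le_anti; rewrite x1 /= -(abs1 nF) -xy (absM nF).
by rewrite ler_piMr ?(abs_ge0 nF).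
Qed.

Lemma padic_abs_p (R : realType) (p : nat) (Qp : fieldType) (abs : Qp -> R) :
  prime p -> is_padic_field p abs -> abs p%:R = p%:R^-1.
Proof.
move=> pp /padic_ratr/(_ p%:R); rewrite ratr_nat => ->.
rewrite /rat_padic_abs pnatr_eq0 gtn_eqF ?prime_gt0 //.
rewrite -[p%:R]/(p%:Z%:Q) numq_int denq_int /= logn1 expn0.
by rewrite -{3}(expn1 p) pfactorK // expn1 mul1r.
Qed.

Theorem proposition3p12
  (R : realType) (p : nat) (p_prime : prime p)
  (Qp : fieldType) (absQp : Qp -> R) (Qp_padic : is_padic_field p absQp)
  (K : fieldExtType Qp) (absK : K -> R) (absK_ext : absval_extends absQp absK)
  (A : set (int -> K)) (A_alg : laurent_subalgebra A)
  (A_const : A `&` power_series K = [set c \*o Tpow K 0 | c in [set: K]])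
  (g : nat) (A_codim : quotient_dim (laurent K) (set_add A (power_series K)) g)
  (mu : 'I_g -> nat) (mu_gaps : gap_enum A mu)
  (A_integral : strictly_integral absK A)
  (d : nat) (p_mod_d : (p = 1 %[mod d])%N) (mu_le_d : forall j, (mu j <= d)%N)
  (zeta : Qp) (zeta_int : absQp zeta <= 1) (zeta_prim : d.-primitive_root zeta)
  (delta_A : scale_var (zeta%:A : K) @` A = A)
  (e : nat -> 'M[K]_g)
  (e_frob : forall k, frobenius_matrix absK A mu (p ^ k)%N (e k))
  (i : 'I_g) (n : nat) (n_gt0 : (0 < n)%N)
  (e_unit : forall k, integer_unit absK (e k i i)) :
  exists (K' : fieldExtType K) (absK' : K' -> R),
    let T := torsion_set p absK' (fun k => e k i i) n in
    [/\ absval_extends absK absK',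
        T #= `I_(p ^ n),
        forall x, T x -> x != 0 ->
          exists2 s : nat, (1 <= s <= n)%N & absK' x = torsion_radius p absK' s
      & forall s : nat, (1 <= s <= n)%N ->
          T `&` [set x | absK' x = torsion_radius p absK' s] #= `I_(p ^ s - p ^ s.-1)].
Proof.
have nK : nonarch_absval absK := absK_ext.1.
have p1 := prime_gt1 p_prime.
apply: torsion_count => //.
- exact: complete_extension absK_ext (padic_complete Qp_padic).
- have -> : absK p%:R = p%:R^-1 by rewrite -(padic_abs_p p_prime Qp_padic) -absK_ext.2 scaler_nat.
  by rewrite invr_gt0 ltr0n prime_gt0 // invf_lt1 ?ltr1n ?ltr0n // prime_gt0.
- by move=> k; apply: integer_unit_abs.
Qed.
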